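(* Let $n\ge 1$ be an integer and $k$ a field. Let $\mathcal{C}$ be a $k$-linear Hom-finite $2n$-Calabi-Yau $(n+2)$-angulated category with split idempotents and $n$-suspension functor $\Sigma^n$. Let $T$ be an Oppermann-Thomas cluster tilting object of $\mathcal{C}$, $\Lambda=\operatorname{End}_{\mathcal{C}}(T)$, and let $\mathcal{D}$ be the essential image of $\mathcal{C}(T,-)\colon\mathcal{C}\to\operatorname{mod}\Lambda$. Then there is a bijection $$\{\text{isomorphism classes of } n\text{-rigid objects in }\mathcal{C}\}\to\{\text{isomorphism classes of }\tau_n\text{-rigid pairs in }\mathcal{D}\}$$ which induces two further bijections $$\{\text{isomorphism classes of maximal } n\text{-rigid objects in }\mathcal{C}\}\to\{\text{isomorphism classes of support }\tau_n\text{-tilting pairs in }\mathcal{D}\},$$ $$\{\text{isomorphism classes of } n\text{-self-perpendicular objects in }\mathcal{C}\}\to\{\text{isomorphism classes of maximal }\tau_n\text{-rigid pairs in }\mathcal{D}\}.$$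
   Context: **$(n+2)$-angulated categories** (Geiss-Keller-Oppermann). An $(n+2)$-angulated category is an additive category $\mathcal{C}$ with an automorphism $\Sigma^n$ (the $n$-suspension functor; the symbol is a single functor, not necessarily an $n$-th power) and a class of sequences $X_0\xrightarrow{d_0}X_1\to\cdots\to X_{n+1}\xrightarrow{d_{n+1}}\Sigma^nX_0$, called $(n+2)$-angles, such that: (F1) the class is closed under isomorphisms, direct sums and direct summands; for every $X$ the sequence $X\xrightarrow{1}X\to0\to\cdots\to0\to\Sigma^nX$ is an $(n+2)$-angle; every morphism $X_0\to X_1$ is the first morphism of an $(n+2)$-angle. (F2) A sequence $X_0\xrightarrow{d_0}X_1\xrightarrow{d_1}\cdots\to X_{n+1}\xrightarrow{d_{n+1}}\Sigma^nX_0$ is an $(n+2)$-angle iff $X_1\xrightarrow{d_1}\cdots\to X_{n+1}\xrightarrow{d_{n+1}}\Sigma^nX_0\xrightarrow{(-1)^n\Sigma^nd_0}\Sigma^nX_1$ is one. (F3) Given two $(n+2)$-angles $X_\bullet,Y_\bullet$ and $\varphi_0\colon X_0\to Y_0$, $\varphi_1\colon X_1\to Y_1$ commuting with the first morphisms, there are $\varphi_2,\dots,\varphi_{n+1}$ completing them to a morphism $(\varphi_0,\dots,\varphi_{n+1},\Sigma^n\varphi_0)$ of sequences. (F4) In (F3) the completion can be chosen so that the mapping cone $X_1\oplus Y_0\to X_2\oplus Y_1\to\cdots\to\Sigma^nX_0\oplus Y_{n+1}\to\Sigma^nX_1\oplus\Sigma^nY_0$ is an $(n+2)$-angle. $\mathcal{C}$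 is *$2n$-Calabi-Yau* if $\mathcal{C}(X,\Sigma^nY)\simeq\operatorname{Hom}_k(\mathcal{C}(Y,\Sigma^nX),k)$ naturally in $X,Y\in\mathcal{C}$. **Notation.** $\mathcal{C}(X,Y)=\operatorname{Hom}_{\mathcal{C}}(X,Y)$. $\operatorname{add}M$ is the full subcategory of direct summands of finite direct sums of copies of $M$. $\operatorname{mod}\Lambda$ is the category of finite-dimensional right $\Lambda$-modules and $\operatorname{proj}\Lambda$ the full subcategory of projectives. **Oppermann-Thomas cluster tilting.** An object $T\in\mathcal{C}$ is (Oppermann-Thomas) cluster tilting if $\mathcal{C}(T,\Sigma^nT)=0$ and for every $C\in\mathcal{C}$ there is an $(n+2)$-angle $T_0\to T_1\to\cdots\to T_n\to C\to\Sigma^nT_0$ with $T_0,\dots,T_n\in\operatorname{add}T$. **Rigidity in $\mathcal{C}$.** An object $X\in\mathcal{C}$ is *$n$-rigid* if $\mathcal{C}(X,\Sigma^nX)=0$; *maximal $n$-rigid* if it is $n$-rigid and $\operatorname{add}X=\{M\in\mathcal{C}\mid\mathcal{C}(X\oplus M,\Sigma^n(X\oplus M))=0\}$; *$n$-self-perpendicular* if $\operatorname{add}X=\{M\in\mathcal{C}\mid\mathcal{C}(X,\Sigma^nM)=0\}=\{M\in\mathcal{C}\mid\mathcal{C}(M,\Sigma^nX)=0\}$. **The category $\mathcal{D}$.** It is known that $\mathcal{D}$ (as a full subcategory) is an $n$-cluster tilting subcategory of $\operatorname{mod}\Lambda$, and that $\mathcal{C}(T,-)$ induces an equivalence $\mathcal{C}/\operatorname{add}\Sigma^nT\simeq\mathcal{D}$.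 The $n$-Auslander-Reiten translation is $\tau_n=\tau\,\Omega^{n-1}$; explicitly, if $P_n\to P_{n-1}\to\cdots\to P_0\to M\to0$ is the start of a minimal projective resolution of $M$, then $\tau_nM=\operatorname{Ker}(\nu P_n\to\nu P_{n-1})$, with $\nu=\operatorname{Hom}_k(\operatorname{Hom}_\Lambda(-,\Lambda),k)$. **Pairs in $\mathcal{D}$.** Consider pairs $(M,P)$ with $M\in\mathcal{D}$, $P\in\operatorname{proj}\Lambda$; two pairs are isomorphic if both components are. - $M$ is *$\tau_n$-rigid* if $\operatorname{Hom}_\Lambda(M,\tau_nM)=0$; $(M,P)$ is a *$\tau_n$-rigid pair* if $M$ is $\tau_n$-rigid and $\operatorname{Hom}_\Lambda(P,M)=0$. - $(M,P)$ is a *maximal $\tau_n$-rigid pair* if (i) for every $N\in\mathcal{D}$: $N\in\operatorname{add}M$ iff $\operatorname{Hom}_\Lambda(M,\tau_nN)=0$, $\operatorname{Hom}_\Lambda(N,\tau_nM)=0$ and $\operatorname{Hom}_\Lambda(P,N)=0$; and (ii) for every $Q\in\operatorname{proj}\Lambda$: $Q\in\operatorname{add}P$ iff $\operatorname{Hom}_\Lambda(Q,M)=0$. - A $\tau_n$-rigid pair $(M,P)$ is a *support $\tau_n$-tilting pair* if (i) for every $N\in\mathcal{D}$, if $(M\oplus N,P)$ is a $\tau_n$-rigid pair then $N\in\operatorname{add}M$; and (ii) for every $Q\in\operatorname{proj}\Lambda$: $Q\in\operatorname{add}P$ iff $\operatorname{Hom}_\Lambda(Q,M)=0$. *)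

(* Defs.v *)
From HB Require Import structures.
From mathcomp Require Import all_boot all_order all_algebra.
Set Implicit Arguments.
Unset Strict Implicit.
Unset Printing Implicit Defensive.
Import GRing.Theory.
Local Open Scope ring_scope.

(* Additive k-linear Hom-finite categories: finite-dimensionality of the
   Hom-spaces is part of [vectType]. The zero object and the biproducts are
   chosen. *)
Record lincat (k : fieldType) := Lincat {
  obj :> Type;
  hom : obj -> obj -> vectType k;
  idm : forall X, hom X X;
  comp : forall X Y Z, hom Y Z -> hom X Y -> hom X Z;
  comp_linearr : forall X Y Z (g : hom Y Z), linear (@comp X Y Z g);
  comp_linearl : forall X Y Z (f : hom X Y), linear ((@comp X Y Z)^~ f);
  compA : forall X Y Z W (h : hom Z W) (g : hom Y Z) (f : hom X Y),
    comp h (comp g f) = comp (comp h g) f;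
  comp1m : forall X Y (f : hom X Y), comp (idm Y) f = f;
  compm1 : forall X Y (f : hom X Y), comp f (idm X) = f;
  zob : obj;
  zob_initial : forall X (f : hom zob X), f = 0;
  zob_terminal : forall X (f : hom X zob), f = 0;
  osum : obj -> obj -> obj;
  inl_ : forall X Y, hom X (osum X Y);
  inr_ : forall X Y, hom Y (osum X Y);
  prl_ : forall X Y, hom (osum X Y) X;
  prr_ : forall X Y, hom (osum X Y) Y;
  prl_inl : forall X Y, comp (prl_ X Y) (inl_ X Y) = idm X;
  prr_inr : forall X Y, comp (prr_ X Y) (inr_ X Y) = idm Y;
  prl_inr : forall X Y, comp (prl_ X Y) (inr_ X Y) = 0;
  prr_inl : forall X Y, comp (prr_ X Y) (inl_ X Y) = 0;
  osum_id : forall X Y,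
    comp (inl_ X Y) (prl_ X Y) + comp (inr_ X Y) (prr_ X Y) = idm (osum X Y)
}.

Arguments hom {k l} X Y.
Arguments idm {k l} X.
Arguments comp {k l X Y Z} g f.
Arguments zob {k l}.
Arguments osum {k l} X Y.
Arguments inl_ {k l} X Y.
Arguments inr_ {k l} X Y.
Arguments prl_ {k l} X Y.
Arguments prr_ {k l} X Y.

Notation "g \oC f" := (comp g f) (at level 40, left associativity).
Notation "X \o+ Y" := (osum X Y) (at level 50, left associativity).

Section CategoryNotions.
Variables (k : fieldType) (C : lincat k).
Implicit Types X Y : C.

Definition is_iso X Y (f : hom X Y) : Prop :=
  exists g : hom Y X, g \oC f = idm X /\ f \oC g = idm Y.

Definition iso_ob X Y : Prop := exists f : hom X Y, is_iso f.

Definition hom_zero X Y : Prop := forall f : hom X Y, f = 0.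

Definition opow X (r : nat) : C := iter r (osum X) zob.

Definition in_add X Y : Prop :=
  exists r Y', iso_ob (Y \o+ Y') (opow X r).

Definition split_idempotents : Prop :=
  forall X (e : hom X X), e \oC e = e ->
  exists Y (p : hom X Y) (i : hom Y X), i \oC p = e /\ p \oC i = idm Y.

Definition sum_mor X Y X' Y' (f : hom X X') (g : hom Y Y') :
    hom (X \o+ Y) (X' \o+ Y') :=
  inl_ X' Y' \oC f \oC prl_ X Y + inr_ X' Y' \oC g \oC prr_ X Y.

(* [seq_ m A B] is the type of sequences A -> Y_1 -> ... -> Y_m -> B of m + 1
   morphisms, with m unspecified intermediate objects. *)
Fixpoint seq_ (m : nat) (A B : C) : Type :=
  match m with
  | 0 => hom A B
  | m'.+1 => {Y : C & (hom A Y * seq_ m' Y B)%type}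
  end.

Definition scons m A Y B (f : hom A Y) (c : seq_ m Y B) : seq_ m.+1 A B :=
  existT _ Y (f, c).

Fixpoint srcons (m : nat) (A B E : C) : seq_ m A B -> hom B E -> seq_ m.+1 A E :=
  match m with
  | 0 => fun f h => @scons 0 _ _ _ f h
  | m'.+1 => fun c h =>
      let: existT Y (f, c1) := c in scons f (srcons c1 h)
  end.

(* Replaces the last morphism f of the sequence by h \oC f. *)
Fixpoint spost (m : nat) (A B E : C) : seq_ m A B -> hom B E -> seq_ m A E :=
  match m with
  | 0 => fun f h => h \oC f
  | m'.+1 => fun c h =>
      let: existT Y (f, c1) := c in scons f (spost c1 h)
  end.

Fixpoint szero (m : nat) (A B : C) : seq_ m A B :=
  match m with
  | 0 => 0 : hom A B
  | m'.+1 => scons (0 : hom A zob) (szero m' zob B)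
  end.

Fixpoint ssum (m : nat) (A B A' B' : C) :
    seq_ m A B -> seq_ m A' B' -> seq_ m (A \o+ A') (B \o+ B') :=
  match m with
  | 0 => fun f f' => sum_mor f f'
  | m'.+1 => fun c c' =>
      let: existT Y (f, c1) := c in
      let: existT Y' (f', c1') := c' in
      scons (sum_mor f f') (ssum c1 c1')
  end.

Fixpoint sall (P : C -> Prop) (m : nat) (A B : C) : seq_ m A B -> Prop :=
  match m with
  | 0 => fun _ => True
  | m'.+1 => fun c => let: existT Y (_, c1) := c in P Y /\ sall P c1
  end.

(* Families of morphisms between the intermediate objects of c and c' which,
   together with a and b at the two ends, make all squares commute. *)
Fixpoint smor (m : nat) (A B A' B' : C) (a : hom A A') (b : hom B B') :
    seq_ m A B -> seq_ m A' B' -> Type :=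
  match m with
  | 0 => fun f f' => b \oC f = f' \oC a
  | m'.+1 => fun c c' =>
      let: existT Y (f, c1) := c in
      let: existT Y' (f', c1') := c' in
      {y : hom Y Y' & ((y \oC f = f' \oC a) * smor y b c1 c1')%type}
  end.

Fixpoint smor_iso (m : nat) (A B A' B' : C) (a : hom A A') (b : hom B B') :
    forall (c : seq_ m A B) (c' : seq_ m A' B'), smor a b c c' -> Prop :=
  match m with
  | 0 => fun _ _ _ => True
  | m'.+1 => fun c c' =>
      match c, c' with
      | existT Y (f, c1), existT Y' (f', c1') =>
          fun phi : smor (m := m'.+1) a b (scons f c1) (scons f' c1') =>
          let: existT y (_, phi1) := phi in is_iso y /\ smor_iso phi1
      end
  end.

(* The matrix ( -f 0 ; a p ) acting on columns, as in the mapping cones of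
   Geiss, Keller and Oppermann. *)
Definition cone_mor A P Y A' (f : hom A Y) (a : hom A A') (p : hom P A') :
    hom (A \o+ P) (Y \o+ A') :=
  inl_ Y A' \oC (- f) \oC prl_ A P
  + inr_ Y A' \oC (a \oC prl_ A P + p \oC prr_ A P).

(* Given phi : c -> c' with end components a : A -> A' and b : B -> B', where
   c is A -> X_1 -> ... -> X_m -> B and c' is A' -> Y_1 -> ... -> Y_m -> B',
   and one more morphism p : P -> A' before c' and x : B -> E after c, this is
   A (+) P -> X_1 (+) A' -> ... -> B (+) Y_m -> E (+) B'. *)
Fixpoint scone (m : nat) (A B A' B' : C) (a : hom A A') (b : hom B B')
    (P E : C) (p : hom P A') (x : hom B E) :
    forall (c : seq_ m A B) (c' : seq_ m A' B'), smor a b c c' ->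
    seq_ m.+1 (A \o+ P) (E \o+ B') :=
  match m with
  | 0 => fun f f' _ => @scons 0 _ _ _ (cone_mor f a p) (cone_mor x b f')
  | m'.+1 => fun c c' =>
      match c, c' with
      | existT Y (f, c1), existT Y' (f', c1') =>
          fun phi : smor (m := m'.+1) a b (scons f c1) (scons f' c1') =>
          let: existT y (_, phi1) := phi in
          scons (cone_mor f a p) (scone f' x phi1)
      end
  end.

End CategoryNotions.

(* Automorphisms of the k-linear category C: k-linear functors which
   are bijective on objects and on Hom-spaces. *)
Record autom (k : fieldType) (C : lincat k) := Autom {
  aut_ob :> C -> C;
  aut_mor : forall X Y : C, hom X Y -> hom (aut_ob X) (aut_ob Y);
  aut_linear : forall X Y, linear (@aut_mor X Y);
  aut_id : forall X, aut_mor (idm X) = idm (aut_ob X);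
  aut_comp : forall X Y Z (g : hom Y Z) (f : hom X Y),
    aut_mor (g \oC f) = aut_mor g \oC aut_mor f;
  aut_ob_bij : bijective aut_ob;
  aut_mor_bij : forall X Y, bijective (@aut_mor X Y)
}.

Arguments aut_mor {k C} a {X Y} f.

Section Angles.
Variables (k : fieldType) (C : lincat k) (S : autom C).

(* The canonical isomorphism S X (+) S Y -> S (X (+) Y). *)
Definition aut_sum (X Y : C) : hom (S X \o+ S Y) (S (X \o+ Y)) :=
  aut_mor S (inl_ X Y) \oC prl_ (S X) (S Y)
  + aut_mor S (inr_ X Y) \oC prr_ (S X) (S Y).

Definition angle_iso n (X Y : C) (c : seq_ n.+1 X (S X)) (d : seq_ n.+1 Y (S Y)) :
    Prop :=
  exists (a : hom X Y) (phi : smor a (aut_mor S a) c d),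
    is_iso a /\ smor_iso phi.

Definition angle_sum n (X Y : C) (c : seq_ n.+1 X (S X)) (d : seq_ n.+1 Y (S Y)) :
    seq_ n.+1 (X \o+ Y) (S (X \o+ Y)) :=
  spost (ssum c d) (aut_sum X Y).

Definition angle_cone n (X0 X1 Y0 Y1 : C)
    (d0 : hom X0 X1) (c : seq_ n X1 (S X0))
    (e0 : hom Y0 Y1) (d : seq_ n Y1 (S Y0))
    (phi0 : hom X0 Y0) (phi1 : hom X1 Y1)
    (phi : smor phi1 (aut_mor S phi0) c d) :
    seq_ n.+1 (X1 \o+ Y0) (S (X1 \o+ Y0)) :=
  spost (scone e0 (aut_mor S d0) phi) (aut_sum X1 Y0).

End Angles.

(* F2 carries the sign (-1)^n; in F4 the last morphism of the cone involves
   -S d_0, without further sign. *)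
Record angulated (k : fieldType) (n : nat) (C : lincat k) := Angulated {
  susp : autom C;
  angle : forall X : C, seq_ n.+1 X (susp X) -> Prop;
  angle_isoF1 : forall (X Y : C)
    (c : seq_ n.+1 X (susp X)) (d : seq_ n.+1 Y (susp Y)),
    angle_iso c d -> angle c -> angle d;
  angle_sumF1 : forall (X Y : C)
    (c : seq_ n.+1 X (susp X)) (d : seq_ n.+1 Y (susp Y)),
    angle c -> angle d -> angle (angle_sum c d);
  angle_summandF1 : forall (X Y : C)
    (c : seq_ n.+1 X (susp X)) (d : seq_ n.+1 Y (susp Y)),
    angle (angle_sum c d) -> angle c /\ angle d;
  angle_trivF1 : forall X : C, angle (scons (idm X) (szero n X (susp X)));
  angle_extF1 : forall (X0 X1 : C) (d0 : hom X0 X1),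
    exists c : seq_ n X1 (susp X0), angle (scons d0 c);
  angle_rotF2 : forall (X0 X1 : C) (d0 : hom X0 X1) (c : seq_ n X1 (susp X0)),
    angle (scons d0 c) <-> angle (srcons c ((-1) ^+ n *: aut_mor susp d0));
  angle_morF3 : forall (X0 X1 Y0 Y1 : C)
    (d0 : hom X0 X1) (c : seq_ n X1 (susp X0))
    (e0 : hom Y0 Y1) (d : seq_ n Y1 (susp Y0))
    (phi0 : hom X0 Y0) (phi1 : hom X1 Y1),
    angle (scons d0 c) -> angle (scons e0 d) ->
    phi1 \oC d0 = e0 \oC phi0 ->
    inhabited (smor phi1 (aut_mor susp phi0) c d);
  angle_coneF4 : forall (X0 X1 Y0 Y1 : C)
    (d0 : hom X0 X1) (c : seq_ n X1 (susp X0))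
    (e0 : hom Y0 Y1) (d : seq_ n Y1 (susp Y0))
    (phi0 : hom X0 Y0) (phi1 : hom X1 Y1),
    angle (scons d0 c) -> angle (scons e0 d) ->
    phi1 \oC d0 = e0 \oC phi0 ->
    exists phi : smor phi1 (aut_mor susp phi0) c d,
      angle (angle_cone d0 e0 phi)
}.

Arguments susp {k n C} a.
Arguments angle {k n C} a {X} c.

Section AngulatedNotions.
Variables (k : fieldType) (n : nat) (C : lincat k) (A : angulated n C).
Local Notation S := (susp A).

(* C(X, S Y) is naturally isomorphic to the dual of C(Y, S X). *)
Definition calabi_yau_2n : Prop :=
  exists phi : forall X Y : C, 'Hom(hom X (S Y), 'Hom(hom Y (S X), k^o)),
    (forall X Y, bijective (phi X Y)) /\
    (forall (X X' Y Y' : C) (f : hom X' X) (g : hom Y Y')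
       (u : hom X (S Y)) (v : hom Y' (S X')),
       phi X' Y' (aut_mor S g \oC u \oC f) v
       = phi X Y u (aut_mor S f \oC v \oC g)).

Definition n_rigid (X : C) : Prop := hom_zero X (S X).

Definition maximal_n_rigid (X : C) : Prop :=
  n_rigid X /\ forall M : C, in_add X M <-> n_rigid (X \o+ M).

Definition n_self_perpendicular (X : C) : Prop :=
  (forall M : C, in_add X M <-> hom_zero X (S M)) /\
  (forall M : C, in_add X M <-> hom_zero M (S X)).

Definition cluster_tilting (T : C) : Prop :=
  hom_zero T (S T) /\
  forall X : C, exists (T0 : C) (c : seq_ n T0 X) (h : hom X (S T0)),
    [/\ in_add T T0, sall (in_add T) c & angle A (srcons c h)].

End AngulatedNotions.

(* Unlike in the library's [falgType], the zero algebra is allowed: it is the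
   endomorphism algebra of a zero object. *)
Record fdalg (k : fieldType) := Fdalg {
  alg_sp :> vectType k;
  amul : alg_sp -> alg_sp -> alg_sp;
  aone : alg_sp;
  amul_linearr : forall a, linear (amul a);
  amul_linearl : forall b, linear (amul^~ b);
  amulA : forall a b c, amul a (amul b c) = amul (amul a b) c;
  amul1 : forall a, amul a aone = a;
  aone_mul : forall a, amul aone a = a
}.

Arguments aone {k f}.

Record rmod (k : fieldType) (L : fdalg k) := Rmod {
  mod_sp :> vectType k;
  act : mod_sp -> L -> mod_sp;
  act_linearr : forall m, linear (act m);
  act_linearl : forall a, linear (act^~ a);
  act1 : forall m, act m aone = m;
  actM : forall m a b, act m (amul a b) = act (act m a) b
}.

Section Modules.
Variables (k : fieldType) (L : fdalg k).
Implicit Types M N P Q : rmod L.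

Definition ract M (a : L) : 'End(M) := linfun (fun m => act m a).

Lemma ractE M a m : ract M a m = act m a.
Proof.
pose h := GRing.isLinear.Build k M M _ _ (@act_linearl k L M a).
pose g : {linear M -> M} := HB.pack (fun m : M => act m a) h.
exact: (lfunE g).
Qed.

Definition homR_defect M N (a : L) (f : 'Hom(M, N)) : 'Hom(M, N) :=
  ((f \o ract M a) - (ract N a \o f))%VF.

Fact homR_defect_linear M N a : linear (@homR_defect M N a).
Proof.
move=> c f g; rewrite /homR_defect comp_lfunDl comp_lfunDr.
by rewrite -comp_lfunZl -comp_lfunZr scalerBr opprD addrACA.
Qed.

(* Hom_L(M, N), as a subspace of the space of k-linear maps; see [mem_homR]. *)
Definition homR M N : {vspace 'Hom(M, N)} :=
  (\bigcap_(a <- vbasis {:L}) lker (linfun (homR_defect (M := M) (N := N) a)))%VS.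

Lemma mem_homR M N (f : 'Hom(M, N)) :
  f \in homR M N <-> forall m a, f (act m a) = act (f m) a.
Proof.
have defE a : (f \in lker (linfun (homR_defect (M := M) (N := N) a)))
    = (homR_defect a f == 0).
  rewrite memv_ker.
  pose h := GRing.isLinear.Build k _ _ _ _ (@homR_defect_linear M N a).
  pose g : {linear 'Hom(M, N) -> 'Hom(M, N)} :=
    HB.pack (@homR_defect M N a) h.
  by rewrite (lfunE g).
have def0 a : homR_defect a f = 0 <-> forall m, f (act m a) = act (f m) a.
  split=> [/lfunP E m | E].
    have := E m; rewrite /homR_defect !lfunE /= !lfunE /= !lfunE /= !ractE.
    by move/eqP; rewrite subr_eq0 => /eqP.
  apply/lfunP => m; rewrite /homR_defect !lfunE /= !lfunE /= !lfunE /= !ractE.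
  by rewrite E subrr.
rewrite /homR; split=> [fin m a | fE].
  have {}fin b : b \in vbasis {:L} -> homR_defect b f = 0.
    move=> bin; apply/eqP; rewrite -defE.
    move: fin; rewrite (big_rem b) //= memv_cap; by case/andP.
  have aE := coord_vbasis (memvf a); rewrite aE.
  pose hl := GRing.isLinear.Build k _ _ _ _ (act_linearr m).
  pose gl : {linear L -> M} := HB.pack (@act _ _ M m) hl.
  pose hr := GRing.isLinear.Build k _ _ _ _ (act_linearr (f m)).
  pose gr : {linear L -> N} := HB.pack (@act _ _ N (f m)) hr.
  rewrite -[act m _]/(gl _) -[act (f m) _]/(gr _) !linear_sum.
  apply: eq_bigr => i _; rewrite !linearZ /=; congr (_ *: _).
  by apply: (def0 _).1; apply: fin; apply: mem_nth; rewrite size_tuple.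
elim/big_ind: _ => [|U V fU fV|a _]; first exact: memvf.
  by rewrite memv_cap fU.
by rewrite defE; apply/eqP/(def0 _).2 => m; apply: fE.
Qed.

Definition mod_iso M N : Prop :=
  exists2 f : 'Hom(M, N), f \in homR M N & bijective f.

Definition projective P : Prop :=
  forall (M N : rmod L) (g : 'Hom(M, N)) (h : 'Hom(P, N)),
    g \in homR M N -> limg g = fullv -> h \in homR P N ->
    exists2 h' : 'Hom(P, M), h' \in homR P M & (g \o h')%VF = h.

Definition submodule M (U : {vspace M}) : Prop :=
  forall m a, m \in U -> act m a \in U.

Definition superfluous M (U : {vspace M}) : Prop :=
  forall V : {vspace M}, submodule V -> (V + U)%VS = fullv -> V = fullv.

Section ModSum.
Variables M N : rmod L.

Definition modsum_act (x : M * N) (a : L) : M * N := (act x.1 a, act x.2 a).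

Fact modsum_linearr x : linear (modsum_act x).
Proof. by move=> c a b; rewrite /modsum_act !act_linearr. Qed.

Fact modsum_linearl a : linear (modsum_act^~ a).
Proof. by move=> c x y; rewrite /modsum_act /= !act_linearl. Qed.

Fact modsum_act1 x : modsum_act x aone = x.
Proof. by case: x => x y; rewrite /modsum_act !act1. Qed.

Fact modsum_actM x a b : modsum_act x (amul a b) = modsum_act (modsum_act x a) b.
Proof. by rewrite /modsum_act !actM. Qed.

Definition modsum : rmod L :=
  @Rmod k L (M * N)%type modsum_act modsum_linearr modsum_linearl modsum_act1
    modsum_actM.

End ModSum.

Section ModPow.
Variables (M : rmod L) (r : nat).

Definition modpow_act (x : {ffun 'I_r -> M}) (a : L) : {ffun 'I_r -> M} :=
  [ffun i => act (x i) a].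

Fact modpow_linearr x : linear (modpow_act x).
Proof. by move=> c a b; apply/ffunP => i; rewrite !ffunE act_linearr. Qed.

Fact modpow_linearl a : linear (modpow_act^~ a).
Proof. by move=> c x y; apply/ffunP => i; rewrite !ffunE act_linearl. Qed.

Fact modpow_act1 x : modpow_act x aone = x.
Proof. by apply/ffunP => i; rewrite !ffunE act1. Qed.

Fact modpow_actM x a b : modpow_act x (amul a b) = modpow_act (modpow_act x a) b.
Proof. by apply/ffunP => i; rewrite !ffunE actM. Qed.

Definition modpow : rmod L :=
  @Rmod k L {ffun 'I_r -> M} modpow_act modpow_linearr modpow_linearl
    modpow_act1 modpow_actM.

End ModPow.

Definition mod_add M N : Prop :=
  exists r N', mod_iso (modsum N N') (modpow M r).

Definition regmod : rmod L :=
  @Rmod k L L (@amul k L) (@amul_linearr k L) (@amul_linearl k L) (@amul1 k L)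
    (fun m a b => amulA m a b).

(* The Nakayama functor nu = Hom_k(Hom_L(-, L), k). The space Hom_L(P, L) is
   a left module by (a f)(p) = a f(p), its dual a right one by
   (u a)(f) = u (a f). *)

Section Nakayama.
Variable P : rmod L.

Local Notation dualP := (subvs_of (homR P regmod)).

Definition lmulL (a : L) : 'End(regmod) := linfun (amul a : regmod -> regmod).

Lemma lmulLE a x : lmulL a x = amul a x.
Proof.
pose h := GRing.isLinear.Build k regmod regmod _ _ (@amul_linearr k L a).
pose g : {linear regmod -> regmod} := HB.pack (amul a : regmod -> regmod) h.
exact: (lfunE g).
Qed.

Definition dual_act (a : L) (f : dualP) : dualP :=
  vsproj (homR P regmod) (lmulL a \o vsval f)%VF.

Lemma dual_actE a f p : vsval (dual_act a f) p = amul a (vsval f p).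
Proof.
rewrite /dual_act vsprojK; first by rewrite lfunE /= lmulLE.
apply/mem_homR => m b; rewrite !lfunE /= !lmulLE.
have /mem_homR -> := subvsP f.
by rewrite /= amulA.
Qed.

Lemma dual_ext (f g : dualP) : (forall p, vsval f p = vsval g p) -> f = g.
Proof. by move=> fg; apply: val_inj; apply/lfunP. Qed.

Lemma dual_valP c (f g : dualP) p :
  vsval (c *: f + g) p = c *: vsval f p + vsval g p.
Proof. by rewrite linearP !lfunE /= !lfunE. Qed.

Fact dual_act_linear a : linear (dual_act a).
Proof.
move=> c f g; apply: dual_ext => p.
by rewrite dual_valP !dual_actE dual_valP amul_linearr.
Qed.

Definition nu_act (u : 'Hom(dualP, k^o)) (a : L) : 'Hom(dualP, k^o) :=
  linfun (fun f => u (dual_act a f)).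

Lemma nu_actE u a f : nu_act u a f = u (dual_act a f).
Proof.
have hl : linear (fun f => u (dual_act a f) : k^o).
  by move=> c x y; rewrite dual_act_linear linearP.
pose h := GRing.isLinear.Build k _ _ _ _ hl.
pose g : {linear dualP -> k^o} := HB.pack (fun f => u (dual_act a f) : k^o) h.
exact: (lfunE g).
Qed.

Fact nu_linearr u : linear (nu_act u).
Proof.
move=> c a b; apply/lfunP => f; rewrite !lfunE /= !lfunE /= !nu_actE.
rewrite -linearP; congr (u _); apply: dual_ext => p.
by rewrite dual_valP !dual_actE amul_linearl.
Qed.

Fact nu_linearl a : linear (nu_act^~ a).
Proof.
move=> c u v; apply/lfunP => f.
by rewrite nu_actE !lfunE /= !lfunE /= !nu_actE.
Qed.

Fact nu_act1 u : nu_act u aone = u.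
Proof.
apply/lfunP => f; rewrite nu_actE; congr (u _); apply: dual_ext => p.
by rewrite dual_actE aone_mul.
Qed.

Fact nu_actM u a b : nu_act u (amul a b) = nu_act (nu_act u a) b.
Proof.
apply/lfunP => f; rewrite !nu_actE; congr (u _); apply: dual_ext => p.
by rewrite !dual_actE amulA.
Qed.

Definition nu : rmod L :=
  @Rmod k L 'Hom(dualP, k^o) nu_act nu_linearr nu_linearl nu_act1 nu_actM.

End Nakayama.

Section NakayamaMor.
Variables (P Q : rmod L) (h : 'Hom(P, Q)).

Definition dual_mor (f : subvs_of (homR Q regmod)) : subvs_of (homR P regmod) :=
  vsproj (homR P regmod) (vsval f \o h)%VF.

Lemma dual_morE f p : h \in homR P Q -> vsval (dual_mor f) p = vsval f (h p).
Proof.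
move=> /mem_homR hh; rewrite /dual_mor vsprojK; first by rewrite lfunE.
apply/mem_homR => m a; rewrite !lfunE /= hh.
by have /mem_homR -> := subvsP f.
Qed.

Fact dual_mor_linear : linear dual_mor.
Proof.
by move=> c x y; rewrite /dual_mor linearP /= comp_lfunDl -comp_lfunZl linearP.
Qed.

Definition nu_mor_fun (u : 'Hom(subvs_of (homR P regmod), k^o)) :
    'Hom(subvs_of (homR Q regmod), k^o) :=
  linfun (fun f => u (dual_mor f)).

Lemma nu_mor_funE u f : nu_mor_fun u f = u (dual_mor f).
Proof.
have hl : linear (fun f => u (dual_mor f) : k^o).
  by move=> c x y; rewrite dual_mor_linear linearP.
pose h1 := GRing.isLinear.Build k _ _ _ _ hl.
pose g : {linear subvs_of (homR Q regmod) -> k^o} :=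
  HB.pack (fun f => u (dual_mor f) : k^o) h1.
exact: (lfunE g).
Qed.

Fact nu_mor_linear : linear nu_mor_fun.
Proof.
move=> c u v; apply/lfunP => f.
by rewrite nu_mor_funE !lfunE /= !lfunE /= !nu_mor_funE.
Qed.

(* This is nu h when h is in Hom_L(P, Q). *)
Definition nu_mor : 'Hom(nu P, nu Q) := linfun nu_mor_fun.

Lemma nu_morE u : nu_mor u = nu_mor_fun u.
Proof.
pose h1 := GRing.isLinear.Build k (nu P) (nu Q) _ _ nu_mor_linear.
pose g : {linear nu P -> nu Q} := HB.pack nu_mor_fun h1.
exact: (lfunE g).
Qed.

End NakayamaMor.

(* X is isomorphic to tau_n M. In terms of the usual notation, the sequence
   Y, d is P_n -> ... -> P_0 -> M, with M = Y 0 and P_i = Y i.+1; the terms of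
   index beyond n + 1 are irrelevant. The projective resolution is minimal as
   each P_i is a projective cover of its image. *)
Definition is_tau (n : nat) M (X : rmod L) : Prop :=
  exists (Y : nat -> rmod L) (d : forall i, 'Hom(Y i.+1, Y i)),
    [/\ mod_iso (Y 0) M,
        limg (d 0) = fullv /\ (forall i, (i < n)%N -> limg (d i.+1) = lker (d i)),
        (forall i, (i <= n)%N ->
          [/\ projective (Y i.+1), d i \in homR (Y i.+1) (Y i)
            & superfluous (lker (d i))])
      & exists i : 'Hom(X, nu (Y n.+1)),
          [/\ i \in homR X (nu (Y n.+1)), lker i = 0%VS
            & limg i = lker (nu_mor (d n))]].

(* Hom_L(M, tau_n N) = 0; the module tau_n N is determined up to isomorphism. *)
Definition hom_tau_zero (n : nat) M N : Prop :=
  exists2 X, is_tau n N X & homR M X = 0%VS.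

End Modules.

Section EndAlgebra.
Variables (k : fieldType) (C : lincat k) (T : C).

Definition End_alg : fdalg k :=
  @Fdalg k (hom T T) (@comp k C T T T) (idm T) (@comp_linearr k C T T T)
    (@comp_linearl k C T T T) (fun a b c => compA a b c)
    (fun a => compm1 a) (fun a => comp1m a).

Definition homT (X : C) : rmod End_alg :=
  @Rmod k End_alg (hom T X) (fun (u : hom T X) (a : hom T T) => u \oC a)
    (fun u => comp_linearr u) (fun a => @comp_linearl k C T T X a)
    (fun u => compm1 u) (fun u a b => compA u a b).

Definition ess_image (M : rmod End_alg) : Prop :=
  exists X, mod_iso (homT X) M.

End EndAlgebra.

Section Pairs.
Variables (k : fieldType) (L : fdalg k) (D : rmod L -> Prop) (n : nat).
Implicit Type p : (rmod L * rmod L)%type.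

Definition pair_iso p q : Prop := mod_iso p.1 q.1 /\ mod_iso p.2 q.2.

Definition is_pair p : Prop := D p.1 /\ projective p.2.

Definition tau_rigid_pair p : Prop :=
  [/\ is_pair p, hom_tau_zero n p.1 p.1 & homR p.2 p.1 = 0%VS].

Definition maximal_tau_rigid_pair p : Prop :=
  [/\ is_pair p,
    (forall N, D N -> (mod_add p.1 N <->
       [/\ hom_tau_zero n p.1 N, hom_tau_zero n N p.1 & homR p.2 N = 0%VS]))
    & (forall Q, projective Q -> (mod_add p.2 Q <-> homR Q p.1 = 0%VS))].

Definition support_tau_tilting_pair p : Prop :=
  [/\ tau_rigid_pair p,
    (forall N, D N -> tau_rigid_pair (modsum p.1 N, p.2) -> mod_add p.1 N)
    & (forall Q, projective Q -> (mod_add p.2 Q <-> homR Q p.1 = 0%VS))].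

End Pairs.

(* Plain predicates instead of the library's classical sets: the type of all
   modules does not fit in the universe of the latter. *)

(* [iso_classes R A] is the collection of the classes {y | R x y}, for x in A. *)
Definition iso_classes (U : Type) (R : U -> U -> Prop) (A : U -> Prop)
    (c : U -> Prop) : Prop :=
  exists2 x, A x & c = R x.

Definition bij_between (U V : Type) (A : U -> Prop) (B : V -> Prop) (f : U -> V) :
    Prop :=
  [/\ forall x, A x -> B (f x),
      forall x y, A x -> A y -> f x = f y -> x = y
    & forall y, B y -> exists2 x, A x & f x = y].

(* Main.v *)
Require Import Defs.
From HB Require Import structures.
From mathcomp Require Import all_boot all_order all_algebra.
From Stdlib Require Import Classical ClassicalEpsilon.
From Stdlib Require Import FunctionalExtensionality PropExtensionality.
(* MathComp's vector library has its own [hom], [comp] and [projective]. *)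
Import Defs.
Set Implicit Arguments.
Unset Strict Implicit.
Unset Printing Implicit Defensive.
Import GRing.Theory.
Local Open Scope ring_scope.

(* Write F = C(T, -) and S for the n-suspension. By cluster tilting and the
   exactness of angles, F is full and its kernel consists of the maps through
   add S T. Every X splits as X' (+) S T' with T' in add T and X' reduced (no
   nonzero summand in add S T), uniquely up to isomorphism, because on a reduced
   object the endomorphisms in the kernel of F are nilpotent; X |-> (F X', F T')
   is thus a bijection from all isomorphism classes of objects to those of pairs.

   It matches the rigidity conditions once, for X' and Y' reduced,
   C(X', S Y') = 0 iff Hom(F X', tau F Y') = 0 = Hom(F Y', tau F X').
   First, tau (F Y') = F (S Y'): an angle T0 -> ... -> Tn -> Y' -> S T0 gives a
   projective resolution of F Y', and by the Calabi-Yau duality the kernel of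
   nu F T0 -> nu F T1 is F (S Y'); the passage to the minimal resolution does not
   change this kernel as Y' is reduced. So both Hom-spaces vanish iff all maps
   X' -> S Y' and Y' -> S X' factor through add S T. As C(T, S T) = 0, the duality
   pairing of C(X', S Y') with C(Y', S X') is zero on such maps, so that both of
   these spaces vanish. *)

(** * Linear categories *)

(** Exactness is extracted from the angles only for the covariant functors [C(W, -)]. The
    contravariant exactness behind the fullness of F, the description of its kernel and the
    computation of tau is then deduced by the Calabi-Yau duality. The main obstacle is minimality:
    tau is defined by a minimal projective resolution, whereas the resolution given by the angle of
    X need not be minimal. Comparing the two leaves an endomorphism of [T0] that differs from the
    identity by a homotopy term and an error; after applying S, the error factors through the
    connecting map [X -> S T0] and becomes an endomorphism of X killed by F. Reducedness is
    therefore stated as invertibility of [1 - u] for every such endomorphism u. It cannot be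
    dropped: for [Y = S T'] one has [F Y = 0], but [F (S Y)] is dual to [C(T', T)], which is nonzero
    for every nonzero T' in add T. *)

Section LinearCategory.
Variables (k : fieldType) (C : lincat k).
Implicit Types X Y Z W : C.

Lemma compDr X Y Z (g : hom Y Z) (f1 f2 : hom X Y) :
  g \oC (f1 + f2) = g \oC f1 + g \oC f2.
Proof. by have := comp_linearr g 1 f1 f2; rewrite !scale1r. Qed.

Lemma compDl X Y Z (g1 g2 : hom Y Z) (f : hom X Y) :
  (g1 + g2) \oC f = g1 \oC f + g2 \oC f.
Proof. by have := comp_linearl f 1 g1 g2; rewrite !scale1r. Qed.

Lemma compm0 X Y Z (g : hom Y Z) : g \oC (0 : hom X Y) = 0.
Proof. by apply: (addIr (g \oC 0)); rewrite -compDr !add0r. Qed.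

Lemma comp0m X Y Z (f : hom X Y) : (0 : hom Y Z) \oC f = 0.
Proof. by apply: (addIr (0 \oC f)); rewrite -compDl !add0r. Qed.

Lemma compZr X Y Z (g : hom Y Z) a (f : hom X Y) : g \oC (a *: f) = a *: (g \oC f).
Proof. by have := comp_linearr g a f 0; rewrite !addr0 compm0 addr0. Qed.

Lemma compZl X Y Z a (g : hom Y Z) (f : hom X Y) : (a *: g) \oC f = a *: (g \oC f).
Proof. by have := comp_linearl f a g 0; rewrite !addr0 comp0m addr0. Qed.

Lemma compNr X Y Z (g : hom Y Z) (f : hom X Y) : g \oC (- f) = - (g \oC f).
Proof. by rewrite -scaleN1r compZr scaleN1r. Qed.

Lemma compNl X Y Z (g : hom Y Z) (f : hom X Y) : (- g) \oC f = - (g \oC f).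
Proof. by rewrite -scaleN1r compZl scaleN1r. Qed.

Lemma compBr X Y Z (g : hom Y Z) (f1 f2 : hom X Y) :
  g \oC (f1 - f2) = g \oC f1 - g \oC f2.
Proof. by rewrite compDr compNr. Qed.

Lemma compBl X Y Z (g1 g2 : hom Y Z) (f : hom X Y) :
  (g1 - g2) \oC f = g1 \oC f - g2 \oC f.
Proof. by rewrite compDl compNl. Qed.

Lemma comp_sumr X Y Z (g : hom Y Z) (I : Type) (r : seq I) (F : I -> hom X Y) :
  g \oC (\sum_(i <- r) F i) = \sum_(i <- r) g \oC F i.
Proof. by apply: (big_morph _ _ (compm0 X g)) => f1 f2; exact: compDr. Qed.

Lemma comp_suml X Y Z (I : Type) (r : seq I) (F : I -> hom Y Z) (f : hom X Y) :
  (\sum_(i <- r) F i) \oC f = \sum_(i <- r) F i \oC f.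
Proof.
by apply: (big_morph (fun g => g \oC f) _ (comp0m Z f)) => g1 g2; exact: compDl.
Qed.

Definition compE := (compDl, compDr, compBl, compBr, compNl, compNr, comp0m, compm0,
  comp1m, compm1).

Lemma is_iso_id X : is_iso (idm X).
Proof. by exists (idm X); rewrite comp1m. Qed.

Lemma iso_ob_refl X : iso_ob X X.
Proof. by exists (idm X); apply: is_iso_id. Qed.

Lemma iso_ob_sym X Y : iso_ob X Y -> iso_ob Y X.
Proof. by case=> f [g [gf fg]]; exists g, f. Qed.

Lemma iso_ob_trans X Y Z : iso_ob X Y -> iso_ob Y Z -> iso_ob X Z.
Proof.
case=> f [g [gf fg]] [f' [g' [gf' fg']]]; exists (f' \oC f), (g \oC g').
split; first by rewrite !compA -(compA g g' f') gf' compm1.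
by rewrite !compA -(compA f' f g) fg compm1.
Qed.

Lemma sided_inverses_iso X Y (f : hom X Y) (g h : hom Y X) :
  is_iso (g \oC f) -> is_iso (f \oC h) -> is_iso f.
Proof.
case=> [u [ugf gfu]] [v [vfh fhv]]; exists (u \oC g); split; first by rewrite -compA.
have E : u \oC g = h \oC v.
  by rewrite -[u \oC g]compm1 -fhv !compA -(compA u g f) ugf comp1m.
by rewrite E compA.
Qed.

(** The geometric series suggests [(1 - y x)^-1 = 1 + y (1 - x y)^-1 x]. This moves invertibility
    between two objects, so that a map through a reduced object can be treated on that object. *)
Lemma iso_id_sub_swap X Y (x : hom X Y) (y : hom Y X) :
  is_iso (idm Y - x \oC y) -> is_iso (idm X - y \oC x).
Proof.
case=> v [vl vr]; exists (idm X + y \oC v \oC x); split.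
  rewrite compDl comp1m (_ : _ \oC (idm X - _) = y \oC x) ?subrK //.
  by rewrite -[y in RHS]compm1 -vl !compE !compA.
rewrite compDr compm1 (_ : (idm X - _) \oC _ = y \oC x) ?subrK //.
by rewrite -[y in RHS]compm1 -vr !compE !compA.
Qed.

Lemma sum_mor_comp X Y X1 Y1 X2 Y2 (f : hom X X1) (g : hom Y Y1)
    (f' : hom X1 X2) (g' : hom Y1 Y2) :
  sum_mor f' g' \oC sum_mor f g = sum_mor (f' \oC f) (g' \oC g).
Proof.
rewrite /sum_mor !compE !compA.
rewrite -!(compA (_ \oC _) (prl_ _ _)) -!(compA (_ \oC _) (prr_ _ _)).
by rewrite !(prl_inl, prr_inr, prl_inr, prr_inl) !compE addr0 add0r.
Qed.

Lemma sum_mor_id X Y : sum_mor (idm X) (idm Y) = idm (X \o+ Y).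
Proof. by rewrite /sum_mor !compm1 osum_id. Qed.

Lemma biproduct_iso X Y W (i : hom X W) (p : hom W X) (j : hom Y W) (q : hom W Y) :
  p \oC i = idm X -> q \oC j = idm Y -> p \oC j = 0 -> q \oC i = 0 ->
  i \oC p + j \oC q = idm W -> iso_ob (X \o+ Y) W.
Proof.
move=> pi qj pj qi ipjq.
exists (i \oC prl_ X Y + j \oC prr_ X Y), (inl_ X Y \oC p + inr_ X Y \oC q).
split.
  rewrite !compE !compA -!(compA _ p) -!(compA _ q) pi pj qi qj !compE.
  by rewrite addr0 add0r osum_id.
rewrite !compE !compA -!(compA _ (prl_ _ _)) -!(compA _ (prr_ _ _)).
by rewrite !(prl_inl, prr_inr, prl_inr, prr_inl) !compE addr0 add0r.
Qed.

Lemma osum_assoc_iso X Y Z : iso_ob ((X \o+ Y) \o+ Z) (X \o+ (Y \o+ Z)).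
Proof.
have E : forall A B : C,
  (prl_ A B \oC inl_ A B = idm A) * (prr_ A B \oC inr_ A B = idm B)
  * (prl_ A B \oC inr_ A B = 0) * (prr_ A B \oC inl_ A B = 0).
  by move=> A B; rewrite prl_inl prr_inr prl_inr prr_inl.
apply: (@biproduct_iso _ _ _
  (inl_ X (Y \o+ Z) \oC prl_ X Y + inr_ X (Y \o+ Z) \oC inl_ Y Z \oC prr_ X Y)
  (inl_ X Y \oC prl_ X (Y \o+ Z) + inr_ X Y \oC prl_ Y Z \oC prr_ X (Y \o+ Z))
  (inr_ X (Y \o+ Z) \oC inr_ Y Z) (prr_ Y Z \oC prr_ X (Y \o+ Z))).
- rewrite !compE !compA -!(compA _ (prl_ X (Y \o+ Z))) -!(compA _ (prr_ X (Y \o+ Z))).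
  by rewrite !E !compE -(compA _ (prl_ Y Z)) E compm1 addr0 add0r osum_id.
- by rewrite compA -(compA (prr_ Y Z)) E compm1 E.
- rewrite !compE !compA -!(compA _ (prl_ _ (Y \o+ Z))) -!(compA _ (prr_ _ (Y \o+ Z))).
  by rewrite !E !compE -(compA _ (prl_ Y Z)) E compm0 addr0.
- by rewrite !compE !compA -!(compA _ (prr_ _ (Y \o+ Z))) !E !compE E !compE addr0.
- rewrite !compE !compA -!(compA _ (prl_ X Y)) -!(compA _ (prr_ X Y)) !E !compE.
  rewrite addr0 add0r -addrA -compDl -!(compA (inr_ X _)) -compDr.
  by rewrite osum_id compm1 osum_id.
Qed.

Lemma iso_ob_osum X Y X' Y' :
  iso_ob X X' -> iso_ob Y Y' -> iso_ob (X \o+ Y) (X' \o+ Y').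
Proof.
case=> f [g [gf fg]] [f' [g' [gf' fg']]]; exists (sum_mor f f'), (sum_mor g g').
by rewrite !sum_mor_comp gf fg gf' fg' !sum_mor_id.
Qed.

Lemma hom_zero_isol X X' Y : iso_ob X X' -> hom_zero X Y <-> hom_zero X' Y.
Proof.
case=> f [g [gf fg]]; split=> z h.
  by rewrite -[h]compm1 -fg compA (z (h \oC f)) comp0m.
by rewrite -[h]compm1 -gf compA (z (h \oC g)) comp0m.
Qed.

Lemma hom_zero_isor X Y Y' : iso_ob Y Y' -> hom_zero X Y <-> hom_zero X Y'.
Proof.
case=> f [g [gf fg]]; split=> z h.
  by rewrite -[h]comp1m -fg -compA (z (g \oC h)) compm0.
by rewrite -[h]comp1m -gf -compA (z (f \oC h)) compm0.
Qed.

Lemma hom_zero_osuml X X' Y :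
  hom_zero (X \o+ X') Y <-> hom_zero X Y /\ hom_zero X' Y.
Proof.
split=> [z|[z z'] h].
  split=> h.
    by rewrite -[h]compm1 -(prl_inl X X') compA (z (h \oC _)) comp0m.
  by rewrite -[h]compm1 -(prr_inr X X') compA (z (h \oC _)) comp0m.
rewrite -[h]compm1 -osum_id compDr !compA (z (h \oC inl_ X X')).
by rewrite (z' (h \oC inr_ X X')) !comp0m addr0.
Qed.

Lemma hom_zero_osumr X Y Y' :
  hom_zero X (Y \o+ Y') <-> hom_zero X Y /\ hom_zero X Y'.
Proof.
split=> [z|[z z'] h].
  split=> h.
    by rewrite -[h]comp1m -(prl_inl Y Y') -compA (z (_ \oC h)) compm0.
  by rewrite -[h]comp1m -(prr_inr Y Y') -compA (z (_ \oC h)) compm0.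
rewrite -[h]comp1m -osum_id compDl -!compA (z (prl_ Y Y' \oC h)).
by rewrite (z' (prr_ Y Y' \oC h)) !compm0 addr0.
Qed.

(** A form of [in_add] that mentions neither a complement nor a power of [X]; the two agree once
    idempotents split ([in_addP]). Transitivity and the vanishing of Hom-spaces become manipulations
    of sums. *)
Definition add_closure X Y : Prop :=
  exists s : seq (hom Y X * hom X Y)%type, \sum_(a <- s) a.2 \oC a.1 = idm Y.

Lemma add_closure_retract X Y (i : hom Y X) (p : hom X Y) :
  p \oC i = idm Y -> add_closure X Y.
Proof. by move=> pi; exists [:: (i, p)]; rewrite big_seq1. Qed.

Lemma add_closure_refl X : add_closure X X.
Proof. by apply: (@add_closure_retract _ _ (idm X) (idm X)); rewrite compm1. Qed.

Lemma add_closure_trans X Y Z :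
  add_closure X Y -> add_closure Y Z -> add_closure X Z.
Proof.
case=> s sE [r rE]; exists [seq (a.1 \oC b.1, b.2 \oC a.2) | b <- r, a <- s].
rewrite big_allpairs_dep -rE; apply: eq_bigr => b _ /=.
rewrite -[b.2 in RHS]compm1 -sE comp_sumr comp_suml.
by apply: eq_bigr => a _; rewrite !compA.
Qed.

Lemma add_closure_iso X Y : iso_ob X Y -> add_closure X Y.
Proof. by case=> f [g [_ fg]]; apply: (add_closure_retract fg). Qed.

Lemma add_closure_osum X Y Z :
  add_closure X Y -> add_closure X Z -> add_closure X (Y \o+ Z).
Proof.
case=> s sE [r rE].
exists ([seq (a.1 \oC prl_ Y Z, inl_ Y Z \oC a.2) | a <- s]
  ++ [seq (a.1 \oC prr_ Y Z, inr_ Y Z \oC a.2) | a <- r]).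
rewrite big_cat !big_map -osum_id -[inl_ Y Z in RHS]compm1 -[inr_ Y Z in RHS]compm1.
rewrite -sE -rE !comp_sumr !comp_suml.
by congr (_ + _); apply: eq_bigr => a _; rewrite !compA.
Qed.

Lemma add_closure_inl X Y : add_closure (X \o+ Y) X.
Proof. exact: (add_closure_retract (prl_inl X Y)). Qed.

Lemma add_closure_inr X Y : add_closure (X \o+ Y) Y.
Proof. exact: (add_closure_retract (prr_inr X Y)). Qed.

Lemma add_closure_zob X : add_closure X zob.
Proof. by exists [::]; rewrite big_nil; apply/esym/zob_initial. Qed.

Lemma add_closure_opow X r : add_closure X (opow X r).
Proof.
elim: r => [|r IH]; first exact: add_closure_zob.
exact: add_closure_osum (add_closure_refl X) IH.
Qed.

Lemma hom_zero_addl X Y W : add_closure X Y -> hom_zero X W -> hom_zero Y W.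
Proof.
case=> s sE z f; rewrite -[f]compm1 -sE comp_sumr big1 // => a _.
by rewrite compA (z (f \oC a.2)) comp0m.
Qed.

Lemma hom_zero_addr X Y W : add_closure X Y -> hom_zero W X -> hom_zero W Y.
Proof.
case=> s sE z f; rewrite -[f]comp1m -sE comp_suml big1 // => a _.
by rewrite -compA (z (a.1 \oC f)) compm0.
Qed.

Lemma sum_factors_opow X Y (s : seq (hom Y X * hom X Y)%type) :
  exists (i : hom Y (opow X (size s))) (p : hom (opow X (size s)) Y),
    p \oC i = \sum_(a <- s) a.2 \oC a.1.
Proof.
elim: s => [|a s [i [p pi]]]; first by exists 0, 0; rewrite big_nil compm0.
exists (inl_ X _ \oC a.1 + inr_ X _ \oC i), (a.2 \oC prl_ X _ + p \oC prr_ X _).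
rewrite big_cons -pi !compE !compA -!(compA _ (prl_ _ _)) -!(compA _ (prr_ _ _)).
by rewrite !(prl_inl, prr_inr, prl_inr, prr_inl) !compE addr0 add0r.
Qed.

Section SplitIdempotents.
Hypothesis splitC : split_idempotents C.

Lemma retract_complement X Y (i : hom Y X) (p : hom X Y) :
  p \oC i = idm Y -> exists Y' (q : hom X Y') (j : hom Y' X),
    [/\ q \oC j = idm Y', p \oC j = 0, q \oC i = 0
      & i \oC p + j \oC q = idm X].
Proof.
move=> pi; have ip : i \oC p \oC i = i by rewrite -compA pi compm1.
have pp : p \oC i \oC p = p by rewrite pi comp1m.
have [|Y' [q [j [jq qj]]]] := splitC (e := idm X - i \oC p).
  by rewrite compBr compm1 compBl comp1m compA ip subrr subr0.
exists Y', q, j; split=> //; last by rewrite jq addrC subrK.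
  by rewrite -[j]compm1 -qj (compA j) jq compA compBr compm1 compA pp subrr comp0m.
by rewrite -[q]comp1m -qj -!compA (compA j q i) jq compBl comp1m ip subrr compm0.
Qed.

Lemma retract_summand X Y (i : hom Y X) (p : hom X Y) :
  p \oC i = idm Y -> exists Y', iso_ob (Y \o+ Y') X.
Proof.
move=> pi; have [Y' [q [j [qj pj qi ipjq]]]] := retract_complement pi.
by exists Y'; apply: (biproduct_iso pi qj pj qi).
Qed.

Lemma in_addP X Y : in_add X Y <-> add_closure X Y.
Proof.
split=> [[r [Y' iso]]|[s sE]].
  apply: (add_closure_trans (add_closure_opow X r)).
  apply: (add_closure_trans (add_closure_iso (iso_ob_sym iso))).
  exact: add_closure_inl.
have [i [p pi]] := sum_factors_opow s.
by have [Y' iso] := retract_summand (etrans pi sE); exists (size s), Y'.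
Qed.

End SplitIdempotents.

(* The powers of x are linearly dependent, so that x^m = x^(m+1) q for some q
   commuting with x, and then x^m q^m is an idempotent. *)
Section Fitting.
Variables (X : C) (x : hom X X).

Definition mpow (y : hom X X) m : hom X X := iter m (comp y) (idm X).

Lemma mpowD y a b : mpow y (a + b) = mpow y a \oC mpow y b.
Proof. by elim: a => [|a IH]; rewrite ?comp1m //= IH compA. Qed.

Lemma mpow_comm y z m : y \oC z = z \oC y -> mpow y m \oC z = z \oC mpow y m.
Proof.
move=> yz; elim: m => [|m IH]; rewrite ?compE //=.
by rewrite -compA IH !compA yz.
Qed.

Lemma mpow_mpow_comm y z m l :
  y \oC z = z \oC y -> mpow y m \oC mpow z l = mpow z l \oC mpow y m.
Proof. by move=> yz; apply: mpow_comm; apply/esym/mpow_comm. Qed.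

Lemma mpow_stable : exists m q, x \oC q = q \oC x /\ mpow x m = mpow x m.+1 \oC q.
Proof.
pose N := (\dim {: hom X X}).+1; pose t := [tuple mpow x i | i < N].
have tE (i : 'I_N) : t`_i = mpow x i by rewrite -tnth_nth tnth_mktuple.
have : ~~ free t.
  apply/negP => /eqP; rewrite size_tuple => E.
  by have := dimvS (subvf <<t>>%VS); rewrite E ltnn.
(* Dependence is used in the form that some power lies in the span of the strictly higher ones, so
   that [x^(m+1)] can be factored out. *)
rewrite freeNE => /existsP[m]; rewrite tE => /coord_span.
set c := coord _ => mE; pose D := (N - m.+1)%N.
exists m, (\sum_(i < D) c i (mpow x m) *: mpow x i); split.
  rewrite comp_sumr comp_suml; apply: eq_bigr => i _.
  by rewrite compZr compZl (@mpow_comm x x).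
rewrite {1}mE comp_sumr; apply: eq_bigr => i _.
have iN : (m.+1 + i < N)%N.
  by have := ltn_ord i; rewrite ltn_subRL.
by rewrite nth_drop (tE (Ordinal iN)) mpowD compZr.
Qed.

Lemma nilpotent_iso m : mpow x m = 0 -> is_iso (idm X - x).
Proof.
pose s j := \sum_(i < j) mpow x i.
have sE j : (idm X - x) \oC s j = idm X - mpow x j.
  elim: j => [|j IH]; first by rewrite /s big_ord0 compm0 subrr.
  by rewrite /s big_ord_recr /= compDr IH compBl comp1m addrA subrK.
have xs j : s j \oC x = x \oC s j.
  rewrite comp_suml comp_sumr; apply: eq_bigr => i _; exact: mpow_comm.
move=> xm0; exists (s m); split; last by rewrite sE xm0 subr0.
by rewrite compBr compm1 xs -[s m in X in X - _]comp1m -compBl sE xm0 subr0.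
Qed.

(** The clauses serve two reductions. The summand cut out by [e] passes through whatever [x] passes
    through, and it is nonzero unless [1 - x] is invertible; by the last clause, a cover unchanged
    by [x] is unchanged by [e]. *)
Lemma fitting_idempotent : exists e v : hom X X,
  [/\ e \oC e = e, e = x \oC v, e = 0 -> is_iso (idm X - x)
    & forall (Z : C) (W : Type) (g : hom Z X -> W),
        (forall t, g (x \oC t) = g t) -> forall t, g (e \oC t) = g t].
Proof.
have [l [q [xq xl]]] := mpow_stable.
have [m [w [mS xm]]] :
    exists m w, mpow x m = x \oC w /\ mpow x m = mpow x m.+1 \oC q.
  by exists l.+1, (mpow x l); split=> //; rewrite -[LHS]/(x \oC mpow x l) {1}xl compA.
have xmj j : mpow x m = mpow x (j + m) \oC mpow q j.
  elim: j => [|j IH]; first by rewrite compm1.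
  have -> : mpow x (j.+1 + m) = mpow x j \oC mpow x m.+1 by rewrite -mpowD addnS.
  have -> : mpow q j.+1 = q \oC mpow q j by [].
  by rewrite compA -(compA (mpow x j)) -xm -mpowD.
have xme := xmj m; rewrite mpowD -compA in xme.
exists (mpow x m \oC mpow q m), (w \oC mpow q m); split.
- rewrite compA -(compA (mpow x m)) (mpow_mpow_comm m m (esym xq)) -xme //.
- by rewrite compA -mS.
- by move=> e0; apply: (@nilpotent_iso m); rewrite xme e0 compm0.
- move=> Z W g gx t.
  have gxm i u : g (mpow x i \oC u) = g u.
    by elim: i u => [|i IH] u; rewrite ?comp1m //= -compA gx IH.
  by rewrite -compA gxm -[RHS](gxm m t) xme -!compA !gxm.
Qed.

End Fitting.
End LinearCategory.

(** * Exactness of angles and reduced objects *)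

Section Automorphism.
Variables (k : fieldType) (C : lincat k) (S : autom C).
Implicit Types X Y Z : C.

Lemma autD X Y (f g : hom X Y) : aut_mor S (f + g) = aut_mor S f + aut_mor S g.
Proof. by have := aut_linear S 1 f g; rewrite !scale1r. Qed.

Lemma aut0 X Y : aut_mor S (0 : hom X Y) = 0.
Proof. by apply: (addIr (aut_mor S 0)); rewrite -autD !add0r. Qed.

Lemma autZ X Y a (f : hom X Y) : aut_mor S (a *: f) = a *: aut_mor S f.
Proof. by have := aut_linear S a f 0; rewrite !addr0 aut0 addr0. Qed.

Lemma autB X Y (f g : hom X Y) : aut_mor S (f - g) = aut_mor S f - aut_mor S g.
Proof. by rewrite autD -scaleN1r autZ scaleN1r. Qed.

Lemma aut_sumE X Y (I : Type) (r : seq I) (F : I -> hom X Y) :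
  aut_mor S (\sum_(i <- r) F i) = \sum_(i <- r) aut_mor S (F i).
Proof. by apply: (big_morph _ _ (aut0 X Y)) => f g; exact: autD. Qed.

Lemma aut_inj X Y : injective (@aut_mor k C S X Y).
Proof. exact: bij_inj (aut_mor_bij S X Y). Qed.

Lemma aut_surj X Y (g : hom (S X) (S Y)) : exists f, g = aut_mor S f.
Proof. by have [h _ hK] := aut_mor_bij S X Y; exists (h g); rewrite hK. Qed.

Lemma aut_ob_surj X : exists X', X = S X'.
Proof. by have [h _ hK] := aut_ob_bij S; exists (h X); rewrite hK. Qed.

Lemma aut_iso X Y : iso_ob (S X) (S Y) <-> iso_ob X Y.
Proof.
split=> -[f [g [gf fg]]]; last first.
  by exists (aut_mor S f), (aut_mor S g); rewrite -!aut_comp gf fg !aut_id.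
have [f' fE] := aut_surj f; have [g' gE] := aut_surj g; exists f', g'.
by split; apply: aut_inj; rewrite aut_comp aut_id -fE -gE.
Qed.

Lemma aut_osum_iso X Y : iso_ob (S X \o+ S Y) (S (X \o+ Y)).
Proof.
apply: (@biproduct_iso _ _ _ _ _ (aut_mor S (inl_ X Y)) (aut_mor S (prl_ X Y))
  (aut_mor S (inr_ X Y)) (aut_mor S (prr_ X Y))); rewrite -!aut_comp.
- by rewrite prl_inl aut_id.
- by rewrite prr_inr aut_id.
- by rewrite prl_inr aut0.
- by rewrite prr_inl aut0.
- by rewrite -autD osum_id aut_id.
Qed.

Lemma aut_zob_iso : iso_ob (S zob) zob.
Proof.
exists 0, 0; rewrite !compm0; split; last exact/esym/zob_initial.
by rewrite -aut_id (zob_initial (idm zob)) aut0.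
Qed.

Lemma aut_add_closure X Y : add_closure (S X) (S Y) <-> add_closure X Y.
Proof.
split=> -[s sE]; last first.
  exists [seq (aut_mor S a.1, aut_mor S a.2) | a <- s].
  rewrite big_map -aut_id -sE aut_sumE; apply: eq_bigr => a _.
  by rewrite aut_comp.
have : exists s' : seq (hom Y X * hom X Y),
    aut_mor S (\sum_(a <- s') a.2 \oC a.1) = \sum_(a <- s) a.2 \oC a.1.
  elim: s {sE} => [|[i p] s [s' IH]]; first by exists [::]; rewrite !big_nil aut0.
  have [i' ->] := aut_surj i; have [p' ->] := aut_surj p.
  by exists ((i', p') :: s'); rewrite !big_cons autD IH aut_comp.
by case=> s' s'E; exists s'; apply: aut_inj; rewrite s'E sE aut_id.
Qed.

Lemma aut_hom_zero X Y : hom_zero (S X) (S Y) <-> hom_zero X Y.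
Proof.
split=> z f; last by have [f' ->] := aut_surj f; rewrite (z f') aut0.
by apply: aut_inj; rewrite aut0; apply: z.
Qed.

Lemma hom_zero_aut_osum X Y Z :
  hom_zero X (S (Y \o+ Z)) <-> hom_zero X (S Y) /\ hom_zero X (S Z).
Proof.
rewrite -hom_zero_osumr; apply: iff_sym; apply: hom_zero_isor.
exact: aut_osum_iso.
Qed.

End Automorphism.

Section Exactness.
Variables (k : fieldType) (C : lincat k).
Implicit Types X Y Z : C.

(** That is, [f] is a weak kernel of [g]. The dual property, that [g] is a weak cokernel of [f],
    comes from the duality in [exact_pair_contra]. *)
Definition exact_pair X Y Z (f : hom X Y) (g : hom Y Z) : Prop :=
  g \oC f = 0 /\ forall W (z : hom W Y), g \oC z = 0 -> exists w, z = f \oC w.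

Lemma exact_pair_scale X Y Z (f : hom X Y) (g : hom Y Z) a :
  a != 0 -> exact_pair f (a *: g) -> exact_pair f g.
Proof.
move=> a0 [gf ex]; split=> [|W z gz].
  by apply/eqP; move/eqP: gf; rewrite compZl scaler_eq0 (negPf a0).
by apply: ex; rewrite compZl gz scaler0.
Qed.

Lemma exact_pair_aut (S : autom C) X Y Z (f : hom X Y) (g : hom Y Z) :
  exact_pair f g -> exact_pair (aut_mor S f) (aut_mor S g).
Proof.
case=> gf ex; split=> [|W z]; first by rewrite -aut_comp gf aut0.
move: z; have [W' ->] := aut_ob_surj S W => z.
have [z' ->] := aut_surj z; rewrite -aut_comp -(aut0 S W') => /aut_inj /ex[w ->].
by exists (aut_mor S w); rewrite aut_comp.
Qed.

Definition shead m (X Y : C) (c : seq_ m X Y) : {Z : C & hom X Z} :=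
  match m return seq_ m X Y -> _ with
  | 0 => fun f => existT (fun Z => hom X Z) Y f
  | m'.+1 => fun c => let: existT Z (f, _) := c in existT (fun Z => hom X Z) Z f
  end c.

(* Only the first j pairs of consecutive morphisms are required to be exact: with j
   as induction variable, rotating an angle reduces exactness to the first pair. *)
Fixpoint exact_upto (j m : nat) (X Y : C) {struct m} : seq_ m X Y -> Prop :=
  match m with
  | 0 => fun _ => True
  | m'.+1 => fun c => let: existT Z (f, c1) := c in
      if j is j'.+1 then exact_pair f (projT2 (shead c1)) /\ exact_upto j' c1
      else True
  end.

Definition exact_seq m (X Y : C) (c : seq_ m X Y) : Prop :=
  forall j, exact_upto j c.

Fixpoint exact_last m (X Y Z : C) : seq_ m X Y -> hom Y Z -> Prop :=
  match m with
  | 0 => fun f g => exact_pair f g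
  | m'.+1 => fun c g => let: existT _ (_, c1) := c in exact_last c1 g
  end.

Lemma exact_upto_srcons j m (X Y Z : C) (c : seq_ m X Y) (g : hom Y Z) :
  exact_upto j (srcons c g) -> exact_upto j c.
Proof.
elim: m j X c => [|m IH] j X c //=; case: c => Y1 [f c] /=.
case: j => // j [ex /IH exc]; split=> //.
by case: m c ex {IH exc} => [|m] // -[Y2 [f2 c2]].
Qed.

Lemma exact_last_srcons m (X Y Z : C) (c : seq_ m X Y) (g : hom Y Z) :
  exact_seq (srcons c g) -> exact_last c g.
Proof.
elim: m X c => [|m IH] X c; first by move=> ex; have [] := ex 1%N.
case: c => Y1 [f c] ex; apply: IH => j.
by have [] := ex j.+1.
Qed.

Lemma exact_last_srcons2 m (X Y Z W : C) (c : seq_ m X Y) (g : hom Y Z) (h : hom Z W) :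
  exact_last (srcons c g) h -> exact_pair g h.
Proof. by elim: m X c => [|m IH] X c //=; case: c => Y1 [f c] /IH. Qed.

Lemma smor_last m (X Y X' Y' Z Z' : C) (a : hom X X') (b : hom Z Z')
    (c : seq_ m X Y) (g : hom Y Z) (c' : seq_ m X' Y') (g' : hom Y' Z') :
  smor a b (srcons c g) (srcons c' g') -> exists y : hom Y Y', b \oC g = g' \oC y.
Proof.
elim: m X X' a c c' => [|m IH] X X' a c c' /=; first by case=> y [_ E]; exists y.
by case: c => Y1 [f c]; case: c' => Y2 [f' c'] [y [_ /IH]].
Qed.

End Exactness.

Section AngleExactness.
Variables (k : fieldType) (n : nat) (C : lincat k) (A : angulated n.+1 C).
Local Notation S := (susp A).
Implicit Types X Y Z : C.

Lemma sign_neq0 m : (-1) ^+ m != 0 :> k.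
Proof. by rewrite signr_eq0. Qed.

(** F3 maps the trivial angle on [X0] to the given one, starting with [idm X0] and [d0]. The third
    object of the trivial angle is zero, so the second square forces [d1 d0 = 0]. *)
Lemma angle_comp0 (X0 X1 X2 : C) (d0 : hom X0 X1) (d1 : hom X1 X2)
    (c : seq_ n X2 (S X0)) :
  angle A (scons d0 (scons d1 c)) -> d1 \oC d0 = 0.
Proof.
move=> ang.
have [|[y [E _]]] := angle_morF3 (angle_trivF1 A X0) ang (phi0 := idm X0) (phi1 := d0).
  by [].
by rewrite -E compm0.
Qed.

(** After one rotation the trivial angle on [W] begins with [W -> 0] and ends with the identity of
    [S W] up to sign. As [d1 z = 0], F3 extends [z] to a map into the rotated given angle. Its last
    square reads [S z = S d0 y], the equal signs cancelling, and [S] is full and faithful. *)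
Lemma angle_exact_head (X0 X1 X2 : C) (d0 : hom X0 X1) (d1 : hom X1 X2)
    (c : seq_ n X2 (S X0)) :
  angle A (scons d0 (scons d1 c)) -> exact_pair d0 d1.
Proof.
move=> ang; split=> [|W z d1z]; first exact: angle_comp0 ang.
have ang' := (angle_rotF2 _ _).1 ang.
have triv := (angle_rotF2 _ _).1 (angle_trivF1 A W).
have [|phi] := angle_morF3 triv ang' (phi0 := z) (phi1 := 0).
  by rewrite d1z compm0.
have [y] := smor_last phi; have [w ->] := aut_surj y.
rewrite aut_id compZr compZl compm1 -aut_comp.
move/(scalerI (sign_neq0 _))/aut_inj => ->; by exists w.
Qed.

Lemma angle_exact X (c : seq_ n.+2 X (S X)) : angle A c -> exact_seq c.
Proof.
move=> ang j; elim: j X c ang => [|j IH] X c ang; first by case: c {ang} => Y [].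
case: c ang => Y [f c] ang.
have /IH/exact_upto_srcons ex := (angle_rotF2 _ _).1 ang.
by split=> //; case: c ang {ex} => Y' [f' c] /angle_exact_head.
Qed.

End AngleExactness.

Section LinearMaps.
Variable k : fieldType.

Lemma functional_factor (V W : vectType k) (f : 'Hom(V, W)) (u : 'Hom(V, k^o)) :
  (forall v, f v = 0 -> u v = 0) -> exists w : 'Hom(W, k^o), forall v, u v = w (f v).
Proof.
move=> fu; exists (u \o f^-1)%VF => v; apply/eqP; rewrite comp_lfunE -subr_eq0 -linearB.
by apply/eqP/fu; rewrite linearB /= limg_lfunVK ?subrr // memv_img ?memvf.
Qed.

Lemma linear_lfun (V W : vectType k) (f : V -> W) :
  linear f -> exists g : 'Hom(V, W), forall v, g v = f v.
Proof.
move=> lin; pose h := GRing.isLinear.Build k V W _ _ lin.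
pose g : {linear V -> W} := HB.pack f h.
by exists (linfun g) => v; exact: (lfunE g).
Qed.

End LinearMaps.

Section CalabiYau.
Variables (k : fieldType) (n : nat) (C : lincat k) (A : angulated n.+1 C).
Hypothesis cyA : calabi_yau_2n A.
Local Notation S := (susp A).
Implicit Types X Y Z : C.

(** If [z f = 0], naturality shows that the functional dual to [z] vanishes on the image of
    composition with [S f], which is the kernel of composition with [S g]. So it factors through the
    latter, and the factor is dual to the required [w]. *)
Lemma exact_pair_contra X Y Z (f : hom X Y) (g : hom Y Z) :
  exact_pair f g -> forall W (z : hom Y W), z \oC f = 0 -> exists w, z = w \oC g.
Proof.
move=> /(exact_pair_aut S) [_ ex] W; have [W' ->] := aut_ob_surj S W => z zf.
have [phi [bij nat]] := cyA.
have nat1 X1 Y1 (x : hom X1 Y1) (u : hom Y1 (S W')) v :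
    phi X1 W' (u \oC x) v = phi Y1 W' u (aut_mor S x \oC v).
  by have := nat Y1 X1 W' W' x (idm W') u v; rewrite aut_id comp1m compm1.
have [|G GE] := @linear_lfun k _ _ (@comp _ _ W' (S Y) (S Z) (aut_mor S g)).
  exact: comp_linearr.
have [|w wE] := @functional_factor k _ _ G (phi Y W' z).
  move=> v; rewrite GE => /ex[v' ->]; rewrite -nat1 zf.
  by rewrite linear0 zero_lfunE.
have [psi _ phiK] := bij Z W'; exists (psi w).
apply: (bij_inj (bij Y W')); apply/lfunP => v.
by rewrite nat1 phiK wE GE.
Qed.

Lemma hom_zero_cy X Y : hom_zero X (S Y) -> hom_zero Y (S X).
Proof.
have [phi [bij _]] := cyA => z u; apply: (bij_inj (bij Y X)).
by apply/lfunP => v; rewrite (z v) !linear0.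
Qed.

End CalabiYau.

(** * Maps killed by C(T, -) and reduced objects *)

Section Ghosts.
Variables (k : fieldType) (C : lincat k) (T : C).
Implicit Types X Y Z : C.

Definition ghost X Y (u : hom X Y) : Prop := forall t : hom T X, u \oC t = 0.

Lemma ghost_compl X Y Z (g : hom Y Z) (f : hom X Y) : ghost f -> ghost (g \oC f).
Proof. by move=> z t; rewrite -compA z compm0. Qed.

Lemma ghost_compr X Y Z (g : hom Y Z) (f : hom X Y) : ghost g -> ghost (g \oC f).
Proof. by move=> z t; rewrite -compA z. Qed.

Lemma ghost_add0 X Y (f : hom X Y) T' (t : hom T' X) :
  add_closure T T' -> ghost f -> f \oC t = 0.
Proof.
case=> s sE z; rewrite -[t]compm1 -sE !comp_sumr big1 // => a _.
by rewrite (compA t) (compA f) z comp0m.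
Qed.

Lemma hom_zero_ghost X Y (f : hom X Y) : hom_zero T X -> ghost f.
Proof. by move=> z t; rewrite (z t) compm0. Qed.

(* If idempotents split: X has no nonzero direct summand Z with Hom(T, Z) = 0. *)
Definition reduced X : Prop := forall u : hom X X, ghost u -> is_iso (idm X - u).

Lemma reduced_add T' : add_closure T T' -> reduced T'.
Proof.
move=> aT u z; rewrite -[u]compm1 (ghost_add0 _ aT z) subr0; exact: is_iso_id.
Qed.

Lemma is_iso_comp X Y Z (g : hom Y Z) (f : hom X Y) :
  is_iso g -> is_iso f -> is_iso (g \oC f).
Proof.
case=> g' [gl gr] [f' [fl fr]]; exists (f' \oC g'); split.
  by rewrite compA -(compA f') gl compm1.
by rewrite compA -(compA g) fr compm1.
Qed.

(** Gaussian elimination: [1 - u inl prl] is invertible by reducedness of [X], and dividing by it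
    leaves a map that differs from the identity by a ghost through [Y]. *)
Lemma reduced_osum X Y : reduced X -> reduced Y -> reduced (X \o+ Y).
Proof.
move=> rX rY u z.
have [v [vw wv]] : is_iso (idm _ - u \oC inl_ X Y \oC prl_ X Y).
  by apply: iso_id_sub_swap; apply: rX; apply: ghost_compl; apply: ghost_compr.
pose w := idm (X \o+ Y) - v \oC u \oC inr_ X Y \oC prr_ X Y.
have -> : idm _ - u = (idm _ - u \oC inl_ X Y \oC prl_ X Y) \oC w.
  rewrite /w compBr compm1 !compA wv comp1m -addrA -opprD -!(compA u) -compDr.
  by rewrite osum_id compm1.
apply: is_iso_comp; first by exists v.
apply: iso_id_sub_swap; apply: rY; apply: ghost_compl.
by apply: ghost_compr; apply: ghost_compl.
Qed.

Lemma reduced_iso X Y (f : hom X Y) (g : hom Y X) : reduced X -> reduced Y ->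
  (forall t : hom T X, g \oC f \oC t = t) -> (forall t : hom T Y, f \oC g \oC t = t) ->
  is_iso f.
Proof.
have sub1 Z (u : hom Z Z) : reduced Z -> (forall t : hom T Z, u \oC t = t) -> is_iso u.
  move=> rZ ut; have -> : u = idm Z - (idm Z - u) by rewrite opprB addrC subrK.
  by apply: rZ => t; rewrite compBl comp1m ut subrr.
move=> rX rY gf fg; apply: (@sided_inverses_iso _ _ _ _ _ g g).
  exact: sub1.
exact: sub1.
Qed.

(** The part of the identity of [Y] that passes through [Z] is a ghost, so the part through [X] is
    invertible; its inverse is absorbed into the terms of the sum. *)
Lemma add_closure_reduced X Z Y : reduced Y -> hom_zero T Z ->
  add_closure (X \o+ Z) Y -> add_closure X Y.
Proof.
move=> rY z [s sE].
pose u := \sum_(a <- s) a.2 \oC inr_ X Z \oC (prr_ X Z \oC a.1).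
have : is_iso (idm Y - u).
  apply: rY => t; rewrite comp_suml big1 // => a _.
  by rewrite -!compA (z (_ \oC (_ \oC t))) !compm0.
have -> : idm Y - u = \sum_(a <- s) a.2 \oC inl_ X Z \oC (prl_ X Z \oC a.1).
  rewrite -sE -sumrB; apply: eq_bigr => a _.
  rewrite -[in X in X - _](compm1 a.2) -osum_id compDr compDl !compA.
  by rewrite addrK.
case=> v [_ E]; exists [seq (prl_ X Z \oC a.1 \oC v, a.2 \oC inl_ X Z) | a <- s].
rewrite big_map -E comp_suml; apply: eq_bigr => a _ /=.
by rewrite !compA.
Qed.

(** Here the part [p i] through [X] is discarded. The reverse composite [i p] is a ghost on a power
    of the reduced object [X], since it passes through [Y], and [iso_id_sub_swap] brings
    invertibility back to [Y]. *)
Lemma add_closure_ghost X Z Y : reduced X -> hom_zero T Y ->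
  add_closure (X \o+ Z) Y -> add_closure Z Y.
Proof.
move=> rX z [s sE].
have [i [p pi]] := sum_factors_opow [seq (prl_ X Z \oC a.1, a.2 \oC inl_ X Z) | a <- s].
have rXr r : reduced (opow X r).
  elim: r => [u _|r IH]; last exact: reduced_osum.
  by rewrite (zob_initial (idm zob - u)) -(zob_initial (idm zob)); apply: is_iso_id.
have : is_iso (idm Y - p \oC i).
  by apply: iso_id_sub_swap; apply: rXr; apply: ghost_compr; apply: hom_zero_ghost.
rewrite pi big_map.
have -> : idm Y - \sum_(a <- s) a.2 \oC inl_ X Z \oC (prl_ X Z \oC a.1)
    = \sum_(a <- s) a.2 \oC inr_ X Z \oC (prr_ X Z \oC a.1).
  rewrite -sE -sumrB; apply: eq_bigr => a _.
  rewrite -[in X in X - _](compm1 a.2) -osum_id compDr compDl !compA.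
  by rewrite addrC addKr.
case=> v [_ E]; exists [seq (prr_ X Z \oC a.1 \oC v, a.2 \oC inr_ X Z) | a <- s].
rewrite big_map -E comp_suml; apply: eq_bigr => a _ /=.
by rewrite !compA.
Qed.

(* The components of an isomorphism and of its inverse are mutually inverse up to
   ghosts, hence invertible. *)
Lemma osum_cancel X X' Z Z' :
  reduced X -> reduced X' -> hom_zero T Z -> hom_zero T Z' ->
  iso_ob (X \o+ Z) (X' \o+ Z') -> iso_ob X X' /\ iso_ob Z Z'.
Proof.
move=> rX rX' z z' [f [g [gf fg]]].
split.
  exists (prl_ X' Z' \oC f \oC inl_ X Z).
  apply: (@reduced_iso _ _ _ (prl_ X Z \oC g \oC inl_ X' Z')) => // t.
    rewrite -!compA (_ : inl_ X' Z' \oC _ = f \oC (inl_ X Z \oC t)).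
      by rewrite !compA -(compA _ g) gf compm1 prl_inl comp1m.
    rewrite -[RHS]comp1m -osum_id compDl -!compA (z' (prr_ X' Z' \oC _)).
    by rewrite compm0 addr0.
  rewrite -!compA (_ : inl_ X Z \oC _ = g \oC (inl_ X' Z' \oC t)).
    by rewrite !compA -(compA _ f) fg compm1 prl_inl comp1m.
  rewrite -[RHS]comp1m -osum_id compDl -!compA (z (prr_ X Z \oC _)).
  by rewrite compm0 addr0.
have key U V U' V' (F : hom (U \o+ V) (U' \o+ V')) (G : hom (U' \o+ V') (U \o+ V)) :
    reduced U' -> hom_zero T V -> G \oC F = idm _ ->
    is_iso (prr_ U V \oC G \oC inr_ U' V' \oC (prr_ U' V' \oC F \oC inr_ U V)).
  move=> rU zV GF.
  pose c := prr_ U V \oC G \oC inl_ U' V'; pose b := prl_ U' V' \oC F \oC inr_ U V.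
  have -> : prr_ U V \oC G \oC inr_ U' V' \oC (prr_ U' V' \oC F \oC inr_ U V)
      = idm V - c \oC b.
    apply/eqP; rewrite eq_sym subr_eq eq_sym; apply/eqP.
    rewrite /c /b !compA -!(compA (prr_ U V \oC G)) -compDr addrC.
    rewrite -!compDl osum_id comp1m -(compA _ G) (compA G) GF comp1m.
    by rewrite prr_inr.
  by apply: iso_id_sub_swap; apply: rU; apply: ghost_compr; apply: hom_zero_ghost.
exists (prr_ X' Z' \oC f \oC inr_ X Z).
by apply: sided_inverses_iso; [apply: (key _ _ _ _ f g)|apply: (key _ _ _ _ g f)].
Qed.

End Ghosts.

(** * Ghosts and decompositions for a cluster tilting object *)

Section ClusterTilting.
Variables (k : fieldType) (n : nat) (C : lincat k) (A : angulated n.+1 C).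
Hypotheses (splitC : split_idempotents C) (cyA : calabi_yau_2n A).
Variables (T : C) (tiltT : cluster_tilting A T).
Local Notation S := (susp A).
Implicit Types X Y Z : C.

Lemma sall_impl (P Q : C -> Prop) m (X Y : C) (c : seq_ m X Y) :
  (forall Z, P Z -> Q Z) -> sall P c -> sall Q c.
Proof.
by move=> PQ; elim: m X c => [|m IH] X c //; case: c => Y1 [f c] [/PQ ? /IH].
Qed.

Lemma tilting_angle X : exists (T0 T1 : C) (d : hom T0 T1) (c : seq_ n T1 X)
    (h : hom X (S T0)),
  [/\ add_closure T T0, add_closure T T1, sall (add_closure T) c,
      exact_seq (scons d c) & exact_last (scons d c) h /\ exact_pair h (aut_mor S d)].
Proof.
have [T0 [c [h [aT0]]]] := tiltT.2 X.
case: c => T1 [d c] [aT1 aTc] ang; exists T0, T1, d, c, h.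
have ex := angle_exact ang.
split.
- exact/(in_addP splitC).
- exact/(in_addP splitC).
- by apply: sall_impl aTc => Z /(in_addP splitC).
- by move=> j; apply: (exact_upto_srcons (ex j)).
split; first exact: exact_last_srcons ex.
have /angle_exact/exact_last_srcons := (angle_rotF2 _ _).1 ang.
by move/exact_last_srcons2/(exact_pair_scale (sign_neq0 _ _)).
Qed.

Lemma exact_last_pair m X Y Z (c : seq_ m X Y) (h : hom Y Z) (P : C -> Prop) :
  P X -> sall P c -> exact_last c h -> exists Y' (l : hom Y' Y), P Y' /\ exact_pair l h.
Proof.
elim: m X c => [|m IH] X c PX; first by exists X, c.
by case: c => Y1 [f c] [PY1 Pc]; apply: IH.
Qed.

Lemma exact_seq_last m X Y Z (c : seq_ m.+1 X Y) (h : hom Y Z) (P : C -> Prop) :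
  P X -> sall P c -> exact_seq c -> exact_last c h ->
  exists X' Y' (d : hom X' Y') (l : hom Y' Y),
    [/\ P X', P Y', exact_pair d l & exact_pair l h].
Proof.
elim: m X c => [|m IH] X c PX; case: c => Y1 [f c] [PY1 Pc] ex last.
  by exists X, Y1, f, c; split=> //; have [] := ex 1%N.
by apply: (IH Y1 c) => // j; have [] := ex j.+1.
Qed.

Lemma tilting_presentation X : exists (T2 T1 T0 : C)
    (d : hom T2 T1) (l : hom T1 X) (h : hom X (S T0)),
  [/\ add_closure T T2, add_closure T T1, add_closure T T0,
      exact_pair d l & exact_pair l h].
Proof.
have [T0 [T1 [d [c [h [aT0 aT1 aTc ex [last _]]]]]]] := tilting_angle X.
have [X' [Y' [d' [l [? ? ? ?]]]]] := exact_seq_last (P := add_closure T)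
  (m := n) (c := scons d c) aT0 (conj aT1 aTc) ex last.
by exists X', Y', T0, d', l, h.
Qed.

Lemma hom_zero_tilting T' T'' :
  add_closure T T' -> add_closure T T'' -> hom_zero T' (S T'').
Proof.
move=> aT' aT''; apply: (hom_zero_addl aT').
by apply: (hom_zero_addr _ tiltT.1); apply/aut_add_closure.
Qed.

(** In the exact pair [T1 -> X -> S T0] a ghost vanishes on [T1], and [X -> S T0] is a weak
    cokernel. *)
Lemma ghost_factor X Y (u : hom X Y) : ghost T u ->
  exists (T0 : C) (a : hom X (S T0)) (b : hom (S T0) Y),
    add_closure T T0 /\ u = b \oC a.
Proof.
move=> z; have [_ [T1 [T0 [_ [l [h [_ aT1 aT0 _ ex]]]]]]] := tilting_presentation X.
have [|b ->] := exact_pair_contra cyA ex (z := u); first exact: ghost_add0 aT1 z.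
by exists T0, h, b.
Qed.

Lemma add_closure_aut_ob T' Z :
  add_closure (S T') Z -> exists2 T'', add_closure T' T'' & Z = S T''.
Proof. by have [T'' ->] := aut_ob_surj S Z => /aut_add_closure; exists T''. Qed.

(** Induction on the dimension of [hom X X]. A ghost [u] with [1 - u] not invertible yields a
    nonzero idempotent [e = u v]. As [u] passes through some [S T0], so does the identity of the
    image [Z] of [e], and [Z] is split off. *)
Lemma reduced_decomposition X : exists X' T',
  [/\ reduced T X', add_closure T T' & iso_ob (X' \o+ S T') X].
Proof.
have [m] := ubnP (\dim {: hom X X}); elim: m X => // m IH X dimX.
have [rX|] := classic (reduced T X).
  exists X, zob; split=> //; first exact: add_closure_zob.
  apply: (@biproduct_iso _ _ _ _ _ (idm X) (idm X) 0 0);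
    rewrite ?compm0 ?comp0m ?compm1 //.
    have /hom_zero_isol z := aut_zob_iso S; symmetry.
    by apply: (z _).2; apply: zob_initial.
  by rewrite addr0.
move=> /not_all_ex_not[u] /(imply_to_and (ghost T u))[z nu].
have [e [v [ee eE e0 _]]] := fitting_idempotent u.
have [T0 [a [b [aT0 uE]]]] := ghost_factor z.
have [Z [p [i [ip pi]]]] := splitC ee.
have [X1 [q [j [qj pj qi ipjq]]]] := retract_complement splitC pi.
have [|T1 aT1 ZE] := @add_closure_aut_ob T0 Z.
  apply: (@add_closure_retract _ _ _ _ (a \oC v \oC i) (p \oC b)).
  rewrite !compA -(compA p) -uE -(compA p) -eE -ip !compA pi comp1m pi //.
have [|X' [T' [rX' aT' iso]]] := IH X1.
  move: dimX; rewrite ltnS; apply: leq_trans.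
  (* Compression to the complement maps [hom X X] onto [hom X1 X1] and kills the nonzero [e], so the
     dimension drops. *)
  have [|F FE] := @linear_lfun k _ _ (fun f : hom X X => q \oC f \oC j).
    by move=> c f g; rewrite compDr compZr compDl compZl.
  have <- : (F @: fullv)%VS = {: hom X1 X1}%VS.
    apply/eqP; rewrite eqEsubv subvf; apply/subvP => f _.
    have -> : f = F (j \oC f \oC q); last exact: memv_img (memvf _).
    by rewrite FE !compA qj comp1m -compA qj compm1.
  rewrite -(limg_ker_dim F fullv) -[X in (X < _)%N]add0n ltn_add2r lt0n dimv_eq0.
  apply/negP => /eqP K; apply: nu; apply: e0.
  apply/eqP; rewrite -memv0 -K memv_cap memvf memv_ker FE -ip !compA qi.
  by rewrite !comp0m eqxx.
exists X', (T' \o+ T1); split=> //.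
  by apply: add_closure_osum => //; apply: add_closure_trans aT1.
have isoS := iso_ob_sym (aut_osum_iso S T' T1).
apply: (iso_ob_trans (iso_ob_osum (iso_ob_refl X') isoS)).
apply: (iso_ob_trans (iso_ob_sym (osum_assoc_iso _ _ _))).
rewrite -ZE; apply: (iso_ob_trans (iso_ob_osum iso (iso_ob_refl _))).
by apply: (biproduct_iso qj pi qi pj); rewrite addrC.
Qed.

Lemma hom_zero_ghosts X Y : hom_zero X (S Y) <->
  (forall f : hom X (S Y), ghost T f) /\ (forall g : hom Y (S X), ghost T g).
Proof.
split=> [z|[gX gY] f].
  by split=> f; rewrite ?(z f) ?(hom_zero_cy cyA z f) => t; rewrite comp0m.
have [T0 [a [b [aT0]]]] := ghost_factor (gX f); have [b' ->] := aut_surj b => ->.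
have [phi [bij nat]] := cyA; apply: (bij_inj (bij X Y)); apply/lfunP => g.
(* The pairing moves [b'] across: [S b' a] paired with [g] is [a] paired with [g b'], and the ghost
   [g] vanishes on maps from [T0]. *)
have := nat X X T0 Y (idm X) b' a g; rewrite compm1 => ->.
by rewrite -compA (ghost_add0 b' aT0 (gY g)) compm0 !linear0 zero_lfunE.
Qed.

End ClusterTilting.

(** * Modules and minimal projective resolutions *)

Section ModuleTheory.
Variables (k : fieldType) (L : fdalg k).
Implicit Types M N P Q : rmod L.

Lemma actDl M (m1 m2 : M) (a : L) : act (m1 + m2) a = act m1 a + act m2 a.
Proof. by have := act_linearl a 1 m1 m2; rewrite !scale1r. Qed.

Lemma act0l M (a : L) : act (0 : M) a = 0.
Proof. by apply: (addIr (act 0 a)); rewrite -actDl !add0r. Qed.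

Lemma actDr M (m : M) (a b : L) : act m (a + b) = act m a + act m b.
Proof. by have := act_linearr m 1 a b; rewrite !scale1r. Qed.

Lemma act0r M (m : M) : act m (0 : L) = 0.
Proof. by apply: (addIr (act m 0)); rewrite -actDr !add0r. Qed.

Lemma actZr M (m : M) c (a : L) : act m (c *: a) = c *: act m a.
Proof. by have := act_linearr m c a 0; rewrite !addr0 act0r addr0. Qed.

Lemma act_suml M (I : Type) (r : seq I) (F : I -> M) (a : L) :
  act (\sum_(i <- r) F i) a = \sum_(i <- r) act (F i) a.
Proof. by apply: (big_morph (fun m => act m a) _ (act0l M a)) => x y; exact: actDl. Qed.

Lemma exists_homR M N (f : M -> N) :
  linear f -> (forall m a, f (act m a) = act (f m) a) ->
  exists2 g : 'Hom(M, N), g \in homR M N & forall m, g m = f m.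
Proof.
move=> /linear_lfun[g gE] fact; exists g => //.
by apply/mem_homR => m a; rewrite !gE.
Qed.

Lemma homR_act M N (f : 'Hom(M, N)) m a :
  f \in homR M N -> f (act m a) = act (f m) a.
Proof. by move/mem_homR. Qed.

Lemma homR_comp M N P (g : 'Hom(N, P)) (f : 'Hom(M, N)) :
  g \in homR N P -> f \in homR M N -> (g \o f)%VF \in homR M P.
Proof.
by move=> gR fR; apply/mem_homR => m a; rewrite !comp_lfunE (homR_act _ _ fR) homR_act.
Qed.

Lemma homR_id M : \1%VF \in homR M M.
Proof. by apply/mem_homR => m a; rewrite !id_lfunE. Qed.

Lemma homR_inverse M N (f : 'Hom(M, N)) (g : N -> M) :
  f \in homR M N -> cancel f g -> cancel g f ->
  exists2 h : 'Hom(N, M), h \in homR N M & forall n, h n = g n.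
Proof.
move=> fR fK gK; apply: exists_homR => [c u v|n a].
  by apply: (can_inj fK); rewrite gK linearP /= !gK.
by apply: (can_inj fK); rewrite homR_act // !gK.
Qed.

Lemma mod_isoP M N : mod_iso M N <-> exists (f : 'Hom(M, N)) (g : 'Hom(N, M)),
  [/\ f \in homR M N, g \in homR N M, cancel f g & cancel g f].
Proof.
split=> [[f fR [g fK gK]]|[f [g [fR _ fK gK]]]]; last by exists f => //; exists g.
have [h hR hE] := homR_inverse fR fK gK.
by exists f, h; split=> // x; rewrite hE.
Qed.

Lemma mod_iso_refl M : mod_iso M M.
Proof. by exists \1%VF; [apply: homR_id|exists id => m; rewrite id_lfunE]. Qed.

Lemma mod_iso_sym M N : mod_iso M N -> mod_iso N M.
Proof. by move=> /mod_isoP[f [g [fR gR fK gK]]]; apply/mod_isoP; exists g, f. Qed.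

Lemma mod_iso_trans M N P : mod_iso M N -> mod_iso N P -> mod_iso M P.
Proof.
move=> [f fR fb] [g gR gb]; exists (g \o f)%VF; first exact: homR_comp.
by apply: (eq_bij (bij_comp gb fb)) => m; rewrite comp_lfunE.
Qed.

Lemma homR_eq0 M N : homR M N = 0%VS <-> forall f, f \in homR M N -> f = 0.
Proof.
split=> [-> f|z]; first by rewrite memv0 => /eqP.
by apply/eqP; rewrite -subv0; apply/subvP => f /z ->; rewrite memv0.
Qed.

Lemma homR_eq0_iso M M' N N' :
  mod_iso M M' -> mod_iso N N' -> homR M N = 0%VS -> homR M' N' = 0%VS.
Proof.
move=> /mod_isoP[u [u' [uR uR' uK uK']]] /mod_isoP[v [v' [vR vR' vK vK']]].
move=> /homR_eq0 z; apply/homR_eq0 => f fR.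
have /lfunP E := z _ (homR_comp (homR_comp vR' fR) uR).
apply/lfunP => m; rewrite -(uK' m) zero_lfunE; apply: (can_inj vK').
by have := E (u' m); rewrite !comp_lfunE zero_lfunE linear0.
Qed.

Lemma modsum_iso M M' N N' :
  mod_iso M M' -> mod_iso N N' -> mod_iso (modsum M N) (modsum M' N').
Proof.
move=> /mod_isoP[u [u' [uR uR' uK uK']]] /mod_isoP[v [v' [vR vR' vK vK']]].
have [||f fR fE] := @exists_homR (modsum M N) (modsum M' N') (fun x => (u x.1, v x.2)).
- by move=> c x y; rewrite /= !linearP.
- by move=> x a; rewrite /= /modsum_act /= !homR_act.
exists f => //; exists (fun x : M' * N' => (u' x.1, v' x.2)) => -[x y]; rewrite fE /=.
  by rewrite uK vK.
by rewrite uK' vK'.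
Qed.

Lemma modpow_iso M M' r : mod_iso M M' -> mod_iso (modpow M r) (modpow M' r).
Proof.
move=> /mod_isoP[u [u' [uR uR' uK uK']]].
have [||f fR fE] := @exists_homR (modpow M r) (modpow M' r)
    (fun x => [ffun i => u (x i)]).
- by move=> c x y; apply/ffunP => i; rewrite !ffunE linearP.
- by move=> x a; apply/ffunP => i; rewrite !ffunE homR_act.
exists f => //; exists (fun x : {ffun 'I_r -> M'} => [ffun i => u' (x i)]) => x.
  by rewrite fE; apply/ffunP => i; rewrite !ffunE uK.
by rewrite fE; apply/ffunP => i; rewrite !ffunE uK'.
Qed.

Lemma mod_add_factors M N : mod_add M N ->
  exists s : seq ('Hom(N, M) * 'Hom(M, N)),
    (forall a, a \in s -> a.1 \in homR N M /\ a.2 \in homR M N) /\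
    forall x, x = \sum_(a <- s) a.2 (a.1 x).
Proof.
case=> r [N' /mod_isoP[u [v [uR vR uK _]]]].
have in_ (i : 'I_r) : exists2 f : 'Hom(M, modpow M r), f \in homR M (modpow M r)
    & forall m, f m = [ffun j => if j == i then m else 0].
  apply: exists_homR => [c x y|x a]; apply/ffunP => j;
    rewrite !ffunE; case: ifP => _ //.
    by rewrite scaler0 addr0.
  by rewrite act0l.
have pr_ (i : 'I_r) : exists2 f : 'Hom(modpow M r, M), f \in homR (modpow M r) M
    & forall m, f m = (m : {ffun 'I_r -> M}) i.
  by apply: exists_homR => [c x y|x a]; rewrite !ffunE.
have [i1 i1R i1E] := @exists_homR N (modsum N N') (fun x => (x, 0))
  ltac:(by move=> c x y; congr (_, _); rewrite /= scaler0 addr0)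
  ltac:(by move=> x a; rewrite /= /modsum_act /= act0l).
have [p1 p1R p1E] := @exists_homR (modsum N N') N (fun x => x.1)
  ltac:(by []) ltac:(by []).
have key (t : seq 'I_r) : exists s : seq ('Hom(N, M) * 'Hom(M, N)),
    (forall a, a \in s -> a.1 \in homR N M /\ a.2 \in homR M N) /\
    forall x, \sum_(a <- s) a.2 (a.1 x) =
      \sum_(i <- t)
        (v [ffun j => if j == i then (u (x, 0) : {ffun 'I_r -> M}) i else 0]).1.
  elim: t => [|i t [s [sR sE]]]; first by exists [::]; split=> // x; rewrite !big_nil.
  have [f fR fE] := in_ i; have [g gR gE] := pr_ i.
  exists (((g \o u \o i1)%VF, (p1 \o v \o f)%VF) :: s); split=> [a|x].
    rewrite inE => /predU1P[->|/sR //].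
    split; first exact: (homR_comp (homR_comp gR uR) i1R).
    exact: (homR_comp (homR_comp p1R vR) fR).
  by rewrite !big_cons sE !comp_lfunE p1E fE gE i1E.
have [s [sR sE]] := key (index_enum _); exists s; split=> // x.
rewrite sE; have {1}-> : x = p1 (v (u (x, 0))) by rewrite uK p1E.
under eq_bigr do rewrite -p1E.
rewrite -!linear_sum /=; congr (p1 (v _)); apply/ffunP => j.
rewrite sum_ffunE (bigD1 j) //= !ffunE eqxx big1 ?addr0 // => i ij.
by rewrite ffunE eq_sym (negPf ij).
Qed.

(** The finite dual basis criterion for projectivity. Unlike [projective] it quantifies over no
    other modules, and it permits lifting along a map restricted to a submodule
    ([dual_basis_lift]). *)
Definition dual_basis P : Prop := exists s : seq (P * 'Hom(P, regmod L)),
  (forall a, a \in s -> a.2 \in homR P (regmod L)) /\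
  forall p, p = \sum_(a <- s) act a.1 (a.2 p).

Lemma dual_basis_extend P M (s : seq (M * 'Hom(P, regmod L))) :
  (forall a, a \in s -> a.2 \in homR P (regmod L)) ->
  exists2 h : 'Hom(P, M), h \in homR P M
    & forall p, h p = \sum_(a <- s) act a.1 (a.2 p).
Proof.
move=> sR; apply: exists_homR => [c x y|x b].
  rewrite scaler_sumr -big_split; apply: eq_bigr => a _ /=.
  by rewrite linearP actDr actZr.
rewrite act_suml big_seq [RHS]big_seq; apply: eq_bigr => a /sR aR.
by rewrite homR_act // actM.
Qed.

Lemma dual_basis_lift P M N (W : {vspace M}) (g : 'Hom(M, N)) (h : 'Hom(P, N)) :
  dual_basis P -> g \in homR M N -> h \in homR P N -> submodule W ->
  (limg h <= g @: W)%VS ->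
  exists h' : 'Hom(P, M),
    [/\ h' \in homR P M, (limg h' <= W)%VS & forall p, g (h' p) = h p].
Proof.
case=> s [sR sE] gR hR subW hW.
(* A preimage inside [W] that is linear only over [k]. Its values are used only at the images of the
   dual basis, and [dual_basis_extend] makes the resulting lift [L]-linear. *)
pose l m := projv W ((g \o projv W)^-1%VF m).
have lW m : l m \in W by rewrite /l memv_proj.
have gl n : n \in (g @: W)%VS -> g (l n) = n.
  move=> nW; rewrite /l -(comp_lfunE g) limg_lfunVK //.
  by rewrite limg_comp limg_proj.
have [|h' h'R h'E] := @dual_basis_extend P M [seq (l (h a.1), a.2) | a <- s].
  by move=> a /mapP[b bs ->]; apply: sR.
exists h'; split=> // [|p].
  apply/subvP => m /memv_imgP[p _ ->]; rewrite h'E big_map.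
  by apply: memv_suml => a _; apply/subW/lW.
rewrite h'E big_map linear_sum [p in RHS]sE linear_sum; apply: eq_bigr => a _ /=.
by rewrite !homR_act // gl // (subvP hW) // memv_img ?memvf.
Qed.

Lemma dual_basis_projective P : dual_basis P -> projective P.
Proof.
move=> dbP M N g h gR gS hR.
have [||h' [h'R _ E]] := @dual_basis_lift P M N fullv g h dbP gR hR.
- by move=> m a _; apply: memvf.
- by rewrite gS subvf.
by exists h' => //; apply/lfunP => p; rewrite comp_lfunE.
Qed.

(** Projectivity splits the surjection from the free module on a [k]-basis of [P]; the coordinates
    of the splitting are the dual functionals. *)
Lemma projective_dual_basis P : projective P -> dual_basis P.
Proof.
move=> prP; pose r := \dim {: P}; pose e := vbasis {: P}.
pose F := modpow (regmod L) r.
have [||g gR gE] := @exists_homR F P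
    (fun x => \sum_(i < r) act e`_i ((x : {ffun _}) i)).
- move=> c x y; rewrite scaler_sumr -big_split; apply: eq_bigr => i _ /=.
  by rewrite !ffunE actDr actZr.
- by move=> x a; rewrite act_suml; apply: eq_bigr => i _; rewrite ffunE -actM.
have gS : limg g = fullv.
  apply/eqP; rewrite eqEsubv subvf; apply/subvP => p _.
  rewrite (_ : p = g [ffun i => coord e i p *: aone]) ?memv_img ?memvf //.
  rewrite gE [LHS](coord_vbasis (memvf p)); apply: eq_bigr => i _.
  by rewrite ffunE actZr act1.
have [h hR hE] := prP F P g \1%VF gR gS (homR_id P).
have pr_ (i : 'I_r) : exists2 f : 'Hom(F, regmod L), f \in homR F (regmod L)
    & forall m, f m = (m : {ffun _}) i.
  by apply: exists_homR => [c x y|x a]; rewrite !ffunE.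
have key (t : seq 'I_r) : exists s : seq (P * 'Hom(P, regmod L)),
    (forall a, a \in s -> a.2 \in homR P (regmod L)) /\
    forall p, \sum_(a <- s) act a.1 (a.2 p)
      = \sum_(i <- t) act e`_i ((h p : {ffun _}) i).
  elim: t => [|i t [s [sR sE]]]; first by exists [::]; split=> // x; rewrite !big_nil.
  have [f fR fE] := pr_ i; exists ((e`_i, (f \o h)%VF) :: s); split=> [a|p].
    rewrite inE => /predU1P[->|/sR //]; exact: (homR_comp fR hR).
  by rewrite !big_cons sE comp_lfunE fE.
have [s [sR sE]] := key (index_enum _); exists s; split=> // p.
by rewrite sE -gE -[LHS]id_lfunE -hE comp_lfunE.
Qed.

Lemma homR_surj_inverse Q (b : 'End(Q)) : b \in homR Q Q -> limg b = fullv ->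
  exists c : 'End(Q), [/\ c \in homR Q Q, cancel b c & cancel c b].
Proof.
move=> bR bS; have b0 : lker b == 0%VS.
  have := limg_ker_dim b fullv; rewrite bS capfv => /eqP.
  by rewrite -[X in _ == X]add0n eqn_add2r dimv_eq0.
have bK := lker0_lfunK b0; have bK' := lker0_lfunVK b0.
by have [c cR cE] := homR_inverse bR bK bK'; exists c; split=> // q; rewrite cE.
Qed.

Lemma superfluous_surj Q Q' (d : 'Hom(Q, Q')) (b : 'End(Q)) :
  superfluous (lker d) -> b \in homR Q Q -> (limg d <= limg (d \o b))%VS ->
  limg b = fullv.
Proof.
move=> sd bR db; apply: sd.
  by move=> _ a /memv_imgP[q _ ->]; rewrite -homR_act // memv_img ?memvf.
apply/eqP; rewrite eqEsubv subvf; apply/subvP => q _.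
have /memv_imgP[q' _ E] := subvP db _ (memv_img d (memvf q)).
rewrite -(subrK (b q') q) addrC; apply: memv_add; first exact: memv_img (memvf _).
by rewrite memv_ker linearB /= E comp_lfunE subrr.
Qed.

(* f, g form a morphism of complexes in both directions between the parts
   e : P -> P' and d : Q -> Q' of two projective resolutions, the second of which
   is minimal; s is a homotopy from g f to the identity. *)
Variant comparison P P' Q Q' (e : 'Hom(P, P')) (d : 'Hom(Q, Q')) : Prop :=
  Comparison f g f' g' s c c' of
    f \in homR P Q & g \in homR Q P & f' \in homR P' Q' & g' \in homR Q' P' &
    s \in homR P' P & c \in homR Q Q & c' \in homR Q' Q' &
    (forall p, f' (e p) = d (f p)) & (forall q, g' (d q) = e (g q)) &
    (forall p, e (g (f p) + s (e p)) = e p) &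
    (forall q, c (f (g q)) = q) & (forall q, f (g (c q)) = q) &
    (forall q, c' (f' (g' q)) = q) & (forall q, f' (g' (c' q)) = q).

Lemma comparison_base P P' Q Q' (e : 'Hom(P, P')) (d : 'Hom(Q, Q')) :
  mod_iso P' Q' -> dual_basis P -> dual_basis Q ->
  e \in homR P P' -> d \in homR Q Q' -> limg e = fullv -> limg d = fullv ->
  superfluous (lker d) -> comparison e d.
Proof.
move=> /mod_isoP[f' [g' [f'R g'R fK gK]]] dP dQ eR dR eS dS sup.
have full M : submodule (fullv : {vspace M}) by move=> m a _; apply: memvf.
have [|f [fR _ fE]] := dual_basis_lift dP dR (homR_comp f'R eR) (full Q).
  by rewrite dS subvf.
have [|g [gR _ gE]] := dual_basis_lift dQ eR (homR_comp g'R dR) (full P).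
  by rewrite eS subvf.
have [||c [cR cK cK']] := @homR_surj_inverse Q (f \o g)%VF.
- exact: homR_comp.
- apply: superfluous_surj sup _ _; first exact: homR_comp.
  apply/subvP => _ /memv_imgP[q _ ->]; apply/memv_imgP; exists q; rewrite ?memvf //.
  by rewrite !comp_lfunE fE comp_lfunE gE comp_lfunE gK.
(* The homotopy is zero at this end: [e g f = e] because [g'] and [f'] are mutually inverse. *)
apply: (@Comparison _ _ _ _ e d f g f' g' 0 c \1%VF) => //.
- exact: mem0v.
- exact: homR_id.
- by move=> p; rewrite fE comp_lfunE.
- by move=> q; rewrite gE comp_lfunE.
- by move=> p; rewrite zero_lfunE addr0 gE comp_lfunE fE comp_lfunE fK.
- by move=> q; have := cK q; rewrite comp_lfunE.
- by move=> q; have := cK' q; rewrite comp_lfunE.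
- by move=> q; rewrite id_lfunE gK.
- by move=> q; rewrite id_lfunE gK.
Qed.

Lemma comparison_step P P' P2 Q Q' Q2 (e : 'Hom(P, P')) (d : 'Hom(Q, Q'))
    (e2 : 'Hom(P2, P)) (d2 : 'Hom(Q2, Q)) :
  comparison e d -> dual_basis P -> dual_basis P2 -> dual_basis Q2 ->
  e \in homR P P' -> d \in homR Q Q' -> e2 \in homR P2 P -> d2 \in homR Q2 Q ->
  limg e2 = lker e -> limg d2 = lker d -> superfluous (lker d2) -> comparison e2 d2.
Proof.
case=> f g f' g' s c c' fR gR f'R g'R sR cR c'R fE gE gfs cfg fgc cfg' fgc'.
move=> dP dP2 dQ2 eR dR e2R d2R exe exd sup.
have full M : submodule (fullv : {vspace M}) by move=> m a _; apply: memvf.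
have ee p : e (e2 p) = 0.
  by apply/eqP; rewrite -memv_ker -exe memv_img ?memvf.
have dd p : d (d2 p) = 0.
  by apply/eqP; rewrite -memv_ker -exd memv_img ?memvf.
have [|f2 [f2R _ f2E]] := dual_basis_lift dP2 d2R (homR_comp fR e2R) (full Q2).
  rewrite exd; apply/subvP => _ /memv_imgP[p _ ->].
  by rewrite memv_ker comp_lfunE -fE ee linear0.
have [|g2 [g2R _ g2E]] := dual_basis_lift dQ2 e2R (homR_comp gR d2R) (full P2).
  rewrite exe; apply/subvP => _ /memv_imgP[p _ ->].
  by rewrite memv_ker comp_lfunE -gE dd linear0.
pose r := (\1 - (g \o f) - (s \o e))%VF.
have rR : r \in homR P P by rewrite !rpredB ?homR_id // homR_comp.
have rE p : r p = p - g (f p) - s (e p).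
  by rewrite !add_lfunE !opp_lfunE id_lfunE !comp_lfunE.
have [|s2 [s2R _ s2E]] := dual_basis_lift dP e2R rR (full P2).
  rewrite exe; apply/subvP => _ /memv_imgP[p _ ->].
  by rewrite memv_ker rE -addrA -opprD linearB /= gfs subrr.
have [||c2 [c2R cK cK']] := @homR_surj_inverse Q2 (f2 \o g2)%VF.
- exact: homR_comp.
- apply: superfluous_surj sup _ _; first exact: homR_comp.
  (* To reach [q] in the kernel of [d], note that [c q] is again in that kernel and write it as
     [d2 q2]; then [d2 (f2 (g2 q2)) = f (g (c q)) = q]. *)
  rewrite exd; apply/subvP => q; rewrite memv_ker => /eqP dq.
  have : c q \in limg d2.
    rewrite exd memv_ker -(cfg' (d (c q))) gE fE.
    by rewrite fgc dq linear0.
  case/memv_imgP => q2 _ E; apply/memv_imgP; exists q2; rewrite ?memvf //.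
  by rewrite !comp_lfunE f2E comp_lfunE g2E comp_lfunE -E fgc.
apply: (@Comparison _ _ _ _ e2 d2 f2 g2 f g s2 c2 c) => //.
- by move=> p; rewrite f2E comp_lfunE.
- by move=> q; rewrite g2E comp_lfunE.
- move=> p; rewrite linearD /= s2E rE ee linear0 subr0 g2E comp_lfunE f2E comp_lfunE.
  by rewrite addrC subrK.
- by move=> q; have := cK q; rewrite comp_lfunE.
- by move=> q; have := cK' q; rewrite comp_lfunE.
Qed.

End ModuleTheory.

(** * The functor C(T, -) *)

Section HomFunctor.
Variables (k : fieldType) (C : lincat k) (T : C).
Implicit Types X Y Z : C.
Local Notation L := (End_alg T).
Local Notation F := (homT T).

Definition homT_mor X Y (x : hom X Y) : 'Hom(F X, F Y) :=
  linfun (fun t : hom T X => x \oC t : hom T Y).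

Lemma homT_morE X Y (x : hom X Y) (t : hom T X) : homT_mor x t = x \oC t.
Proof.
pose h := GRing.isLinear.Build k (F X) (F Y) _ _ (@comp_linearr k C T X Y x).
pose g : {linear F X -> F Y} := HB.pack (fun t : hom T X => x \oC t : hom T Y) h.
exact: (lfunE g).
Qed.

Lemma homT_mor_homR X Y (x : hom X Y) : homT_mor x \in homR (F X) (F Y).
Proof. by apply/mem_homR => m a; rewrite !homT_morE /= compA. Qed.

Lemma homT_iso X Y : iso_ob X Y -> mod_iso (F X) (F Y).
Proof.
move=> [f [g [gf fg]]]; apply/mod_isoP; exists (homT_mor f), (homT_mor g).
split; rewrite ?homT_mor_homR // => t; rewrite !homT_morE compA ?gf ?fg comp1m //.
Qed.

Lemma homT_osum X Y : mod_iso (F (X \o+ Y)) (modsum (F X) (F Y)).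
Proof.
have [||f fR fE] := @exists_homR _ _ (F (X \o+ Y)) (modsum (F X) (F Y))
    (fun t => (prl_ X Y \oC t, prr_ X Y \oC t)).
- by move=> c x y; rewrite !comp_linearr.
- by move=> x a; rewrite /= !compA.
exists f => //; exists (fun t : F X * F Y => inl_ X Y \oC t.1 + inr_ X Y \oC t.2) => t.
  by rewrite fE /= !compA -compDl osum_id comp1m.
rewrite fE; case: t => x y /=; rewrite !compDr !compA.
by rewrite prl_inl prl_inr prr_inl prr_inr !compE addr0 add0r.
Qed.

Lemma homT_osum_zero X Z : hom_zero T Z -> mod_iso (F (X \o+ Z)) (F X).
Proof.
move=> z; apply/mod_isoP; exists (homT_mor (prl_ X Z)), (homT_mor (inl_ X Z)).
split; rewrite ?homT_mor_homR // => t; rewrite !homT_morE compA.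
  rewrite -[RHS]comp1m -osum_id compDl -!compA (z (prr_ X Z \oC t)).
  by rewrite compm0 addr0.
by rewrite prl_inl comp1m.
Qed.

Lemma opow_biproduct X r :
  exists (i : 'I_r -> hom X (opow X r)) (p : 'I_r -> hom (opow X r) X),
  (forall a b, p a \oC i b = if a == b then idm X else 0)
  /\ \sum_a i a \oC p a = idm (opow X r).
Proof.
elim: r => [|r [i [p [pi ip]]]].
  exists (fun=> 0), (fun=> 0); split=> [[]//|].
  by rewrite big_ord0; apply/esym/zob_initial.
exists (fun a => if unlift ord0 a is Some b then inr_ X _ \oC i b else inl_ X _).
exists (fun a => if unlift ord0 a is Some b then p b \oC prr_ X _ else prl_ X _).
split=> [a b|].
  have [a'|] := unliftP ord0 a => ->; have [b'|] := unliftP ord0 b => ->.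
  - rewrite compA -(compA (p a')) prr_inr compm1 pi.
    by rewrite (inj_eq (@lift_inj _ ord0)).
  - by rewrite -compA prr_inl compm0.
  - by rewrite compA prl_inr comp0m.
  - by rewrite prl_inl eqxx.
rewrite big_ord_recl unlift_none -osum_id; congr (_ + _).
rewrite -[inr_ X _ in RHS]compm1 -ip comp_sumr comp_suml.
by apply: eq_bigr => a _; rewrite liftK !compA.
Qed.

Lemma homT_opow X r : mod_iso (F (opow X r)) (modpow (F X) r).
Proof.
have [i [p [pi ip]]] := opow_biproduct X r.
have [||f fR fE] := @exists_homR _ _ (F (opow X r)) (modpow (F X) r)
    (fun t => [ffun a => p a \oC t]).
- by move=> c x y; apply/ffunP => a; rewrite !ffunE comp_linearr.
- by move=> x b; apply/ffunP => a; rewrite !ffunE /= compA.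
exists f => //; exists (fun t : {ffun 'I_r -> hom T X} => \sum_a i a \oC t a) => t.
  rewrite fE -[RHS]comp1m -ip comp_suml; apply: eq_bigr => a _.
  by rewrite ffunE compA.
rewrite fE; apply/ffunP => a; rewrite ffunE comp_sumr (bigD1 a) //= big1 => [|b ab].
  by rewrite compA pi eqxx comp1m addr0.
by rewrite compA pi eq_sym (negPf ab) comp0m.
Qed.

Lemma mod_add_homT X Y M N : in_add X Y -> mod_iso (F X) M -> mod_iso (F Y) N ->
  mod_add M N.
Proof.
case=> r [Y' iso] isoM isoN; exists r, (F Y').
apply: mod_iso_trans (modpow_iso r isoM).
apply: mod_iso_trans (homT_opow X r); apply: mod_iso_trans (homT_iso iso).
apply: mod_iso_trans (mod_iso_sym (homT_osum _ _)).
by apply: modsum_iso; [apply: mod_iso_sym|apply: mod_iso_refl].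
Qed.

Lemma homT_full_add T' Y (h : 'Hom(F T', F Y)) :
  add_closure T T' -> h \in homR (F T') (F Y) -> exists x, h = homT_mor x.
Proof.
case=> s sE hR; exists (\sum_(a <- s) (h a.2 : hom T Y) \oC a.1).
apply/lfunP => t; rewrite homT_morE comp_suml.
rewrite -[t in LHS]comp1m -sE comp_suml linear_sum; apply: eq_bigr => a _.
rewrite -!compA; exact: (homR_act (a.2 : F T') (a.1 \oC t : L) hR).
Qed.

Lemma homT_mor_inj T' Y (x y : hom T' Y) :
  add_closure T T' -> (forall t : hom T T', x \oC t = y \oC t) -> x = y.
Proof.
case=> s sE xy; rewrite -[x]compm1 -[y]compm1 -sE !comp_sumr.
by apply: eq_bigr => a _; rewrite !compA xy.
Qed.

Lemma homT_dual_basis T' : add_closure T T' -> dual_basis (F T').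
Proof.
case=> s sE; exists [seq (a.2, homT_mor a.1 : 'Hom(F T', regmod L)) | a <- s].
split=> [a /mapP[b _ ->]|t]; first exact: homT_mor_homR.
rewrite big_map -[LHS]comp1m -sE comp_suml; apply: eq_bigr => a _.
by rewrite homT_morE -compA.
Qed.

Lemma homR_homT_zero T' Y :
  add_closure T T' -> homR (F T') (F Y) = 0%VS <-> hom_zero T' Y.
Proof.
move=> aT; rewrite homR_eq0; split=> z f.
  apply: (homT_mor_inj aT) => t.
  by rewrite -homT_morE (z _ (homT_mor_homR f)) zero_lfunE comp0m.
case/(homT_full_add aT) => x ->; apply/lfunP => t.
by rewrite homT_morE (z x) comp0m zero_lfunE.
Qed.

Section Covers.
Hypothesis splitC : split_idempotents C.

(** A dual basis presents [P] as a retract of [F] of a power of [T]. By Yoneda the corresponding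
    idempotent comes from an endomorphism of that power, where it splits. *)
Lemma projective_homT P :
  projective P -> exists2 T', add_closure T T' & mod_iso (F T') P.
Proof.
case/projective_dual_basis => s [sR sE]; pose r := size s.
pose x0 := (0 : P, 0 : 'Hom(P, regmod L)).
have [i [p [pi ip]]] := opow_biproduct T r.
have [||f fR fE] := @exists_homR _ _ P (F (opow T r))
    (fun m => \sum_(a < r) i a \oC ((nth x0 s a).2 m : hom T T)).
- move=> c x y; rewrite scaler_sumr -big_split; apply: eq_bigr => a _ /=.
  by rewrite linearP comp_linearr.
- move=> x a; rewrite /= comp_suml; apply: eq_bigr => b _.
  rewrite -compA; congr (_ \oC _).
  exact: (homR_act x a (sR _ (mem_nth x0 (ltn_ord b)))).
have [||g gR gE] := @exists_homR _ _ (F (opow T r)) P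
    (fun t => \sum_(a < r) act (nth x0 s a).1 (p a \oC t : L)).
- move=> c x y; rewrite scaler_sumr -big_split; apply: eq_bigr => a _ /=.
  by rewrite comp_linearr actDr actZr.
- move=> x a; rewrite act_suml; apply: eq_bigr => b _.
  by rewrite -actM /= compA.
have gf m : g (f m) = m.
  rewrite gE [RHS]sE (big_nth x0) big_mkord; apply: eq_bigr => a _.
  rewrite fE comp_sumr (bigD1 a) //= big1 => [|b ab].
    by rewrite compA pi eqxx comp1m addr0.
  by rewrite compA pi eq_sym (negPf ab) comp0m.
have aT := add_closure_opow T r.
have [e eE] := homT_full_add aT (homR_comp fR gR).
have eE' t : e \oC t = f (g t) by rewrite -homT_morE -eE comp_lfunE.
have [|T' [q [j [jq qj]]]] := splitC (e := e).
  by apply: (homT_mor_inj aT) => t; rewrite -compA !eE' gf.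
exists T'; first exact: add_closure_trans aT (add_closure_retract qj).
apply/mod_isoP; exists (g \o homT_mor j)%VF, (homT_mor q \o f)%VF.
split; rewrite ?homR_comp ?homT_mor_homR // => m; rewrite !comp_lfunE !homT_morE.
  have qej : q \oC e \oC j = idm T' by rewrite -jq !compA qj comp1m.
  by rewrite -eE' !compA qej comp1m.
by rewrite compA jq eE' !gf.
Qed.

Lemma submodule_cover (M : rmod L) (V : {vspace M}) : submodule V ->
  exists T' (g : 'Hom(F T', M)),
    [/\ add_closure T T', g \in homR (F T') M, limg g = V & superfluous (lker g)].
Proof.
move=> subV.
have [T1 [g1 [aT1 g1R g1V]]] : exists T' (g : 'Hom(F T', M)),
    [/\ add_closure T T', g \in homR (F T') M & limg g = V].
  have key (vs : seq M) : {subset vs <= V} -> exists T' (g : 'Hom(F T', M)),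
    [/\ add_closure T T', g \in homR (F T') M, {subset vs <= limg g}
      & (limg g <= V)%VS].
    elim: vs => [_|v vs IH sub].
      exists zob, 0; split=> //; [exact: add_closure_zob|exact: mem0v|].
      by apply/subvP => _ /memv_imgP[? _ ->]; rewrite zero_lfunE mem0v.
    have [|T' [g [aT gR gvs gV]]] := IH.
      by move=> x xs; apply: sub; rewrite inE xs orbT.
    have [||h hR hE] := @exists_homR _ _ (F (T \o+ T')) M
        (fun t => act v (prl_ T T' \oC t : L) + g (prr_ T T' \oC t)).
    - by move=> c x y; rewrite !comp_linearr actDr actZr linearP scalerDr addrACA.
    - move=> x a; rewrite actDl -actM -homR_act //=.
      by rewrite !compA.
    exists (T \o+ T'), h; split=> //.
    - exact: add_closure_osum (add_closure_refl T) aT.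
    - move=> x; rewrite inE => /predU1P[->|/gvs/memv_imgP[t _ ->]].
        have -> : v = h (inl_ T T'); last exact: memv_img (memvf _).
        by rewrite hE prl_inl prr_inl linear0 addr0 act1.
      have -> : g t = h (inr_ T T' \oC t); last exact: memv_img (memvf _).
      by rewrite hE !compA prl_inr prr_inr comp0m comp1m act0r add0r.
    - apply/subvP => _ /memv_imgP[t _ ->]; rewrite hE rpredD //.
        by apply: subV; apply: sub; rewrite mem_head.
      by apply: (subvP gV); rewrite memv_img ?memvf.
  have [|T' [g [aT gR gvs gV]]] := key (vbasis V); first by move=> x /vbasis_mem.
  exists T', g; split=> //; apply/eqP; rewrite eqEsubv gV /=.
  by rewrite -[V in (V <= _)%VS](span_basis (vbasisP V)); apply/span_subvP.
have [m] := ubnP (\dim {: F T1}).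
elim: m T1 g1 aT1 g1R g1V => // m IH T1 g1 aT1 g1R g1V dimT1.
have [sup|nsup] := classic (superfluous (lker g1)); first by exists T1, g1.
have [W [subW WK Wneq]] : exists W : {vspace F T1},
    [/\ submodule W, (W + lker g1)%VS = fullv & W <> fullv].
  apply: NNPP => none; apply: nsup => W subW WK; apply: NNPP => Wneq.
  by apply: none; exists W.
have dW : (\dim W < \dim {: F T1})%N.
  rewrite ltnNge; apply/negP => le; apply: Wneq.
  by apply/eqP; rewrite eqEdim subvf.
have [|h [hR hW gh]] := dual_basis_lift (homT_dual_basis aT1) g1R g1R subW.
  apply/subvP => _ /memv_imgP[t _ ->].
  have : t \in (W + lker g1)%VS by rewrite WK memvf.
  case/memv_addP => w wW [x]; rewrite memv_ker => /eqP gx ->.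
  by rewrite linearD /= gx addr0 memv_img.
have [x xE] := homT_full_add aT1 hR.
have [e [v [ee eE _ eg]]] := fitting_idempotent x.
have [T' [p [i [ip pi]]]] := splitC ee.
have ge t : g1 (e \oC t) = g1 t.
  by apply: (eg _ _ g1) => u; rewrite -[RHS]gh xE homT_morE.
apply: (IH T' (g1 \o homT_mor i)%VF).
- exact: add_closure_trans aT1 (add_closure_retract pi).
- by rewrite homR_comp ?homT_mor_homR.
- apply/eqP; rewrite eqEsubv -{1}g1V limg_comp limgS ?subvf //=.
  rewrite -{1}g1V; apply/subvP => _ /memv_imgP[t _ ->].
  rewrite -ge -ip -compA -[_ \oC (_ \oC _)]homT_morE.
  by rewrite -limg_comp -(comp_lfunE g1) memv_img ?memvf.
(* [F T'] embeds into the proper submodule [W], because [i = e i = x v i]. *)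
- move: dimT1; rewrite ltnS; apply: leq_trans; apply: leq_trans dW; rewrite ltnS.
  have i0 : (fullv :&: lker (homT_mor i))%VS = 0%VS.
    apply/eqP; rewrite -subv0; apply/subvP => t; rewrite memv_cap memv_ker homT_morE.
    case/andP => _ /eqP it; rewrite memv0 -[t]comp1m -pi -compA it compm0 //.
  rewrite -(limg_dim_eq i0) dimvS //; apply/subvP => _ /memv_imgP[t _ ->].
  rewrite homT_morE -[i]compm1 -pi compA ip eE -!compA -homT_morE -xE.
  by apply: (subvP hW); rewrite memv_img ?memvf.
Qed.

End Covers.
End HomFunctor.

(** * The higher Auslander-Reiten translation *)

Section Resolution.
Variables (k : fieldType) (C : lincat k) (T : C) (splitC : split_idempotents C).
Local Notation L := (End_alg T).

(** The state of the recursion in [minimal_resolution]: the next cover depends on the previous map,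
    and [L]-linearity is carried along so that its kernel is a submodule. *)
Record module_map := ModuleMap {
  mm_tgt : rmod L;
  mm_src : rmod L;
  mm_map : 'Hom(mm_src, mm_tgt);
  mm_homR : mm_map \in homR mm_src mm_tgt }.

Lemma submodule_projective_cover (M : rmod L) (V : {vspace M}) : submodule V ->
  exists (P : rmod L) (g : 'Hom(P, M)),
    [/\ projective P, g \in homR P M, limg g = V & superfluous (lker g)].
Proof.
move=> /(submodule_cover splitC)[T' [g [aT gR gV sup]]]; exists (homT T T'), g.
by split=> //; apply/dual_basis_projective/homT_dual_basis.
Qed.

Lemma minimal_resolution (N : rmod L) :
  exists (Y : nat -> rmod L) (d : forall i, 'Hom(Y i.+1, Y i)),
  [/\ mod_iso (Y 0) N, limg (d 0) = fullv, forall i, limg (d i.+1) = lker (d i)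
    & forall i, [/\ projective (Y i.+1), d i \in homR (Y i.+1) (Y i)
                  & superfluous (lker (d i))]].
Proof.
have cover (M : rmod L) (V : {vspace M}) : exists f : {P : rmod L & 'Hom(P, M)},
    submodule V -> [/\ projective (projT1 f), projT2 f \in homR (projT1 f) M,
      limg (projT2 f) = V & superfluous (lker (projT2 f))].
  have [subV|nsubV] := classic (submodule V); last first.
    (* A dummy value, so that covers can be chosen for all subspaces at once; the recursion only
       meets submodules. *)
    by exists (existT (fun P : rmod L => 'Hom(P, M) : Type) M (0 : 'Hom(M, M))).
  by have [P [g ?]] := submodule_projective_cover subV; exists (existT _ P g).
pose cov (M : rmod L) V :=
  proj1_sig (constructive_indefinite_description _ (cover M V)).
have covP (M : rmod L) (V : {vspace M}) : submodule V ->
    [/\ projective (projT1 (cov M V)), projT2 (cov M V) \in homR (projT1 (cov M V)) M,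
      limg (projT2 (cov M V)) = V & superfluous (lker (projT2 (cov M V)))].
  exact: (proj2_sig (constructive_indefinite_description _ (cover M V))).
have subker (f : module_map) : submodule (lker (mm_map f)).
  by move=> m a; rewrite !memv_ker homR_act ?mm_homR // => /eqP ->; rewrite act0l.
have subfull : submodule {: N} by move=> m a _; apply: memvf.
have covR (M : rmod L) (V : {vspace M}) (sV : submodule V) :
    projT2 (cov M V) \in homR (projT1 (cov M V)) M by have [] := covP M V sV.
pose st := fix st (i : nat) : module_map :=
  match i with
  | 0 => ModuleMap (covR N fullv subfull)
  | j.+1 => ModuleMap (covR _ _ (subker (st j)))
  end.
exists (fun i => mm_tgt (st i)), (fun i => mm_map (st i)); split.
- exact: mod_iso_refl.
- by have [] := covP N fullv subfull.
- by move=> i; have [] := covP _ _ (subker (st i)).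
- case=> [|i]; first by have [? ? _ ?] := covP N fullv subfull.
  by have [? ? _ ?] := covP _ _ (subker (st i)).
Qed.

End Resolution.

(** * The translation of F X for a reduced object X *)

Section TauModule.
Variables (k : fieldType) (n : nat) (C : lincat k) (A : angulated n.+1 C).
Hypotheses (splitC : split_idempotents C) (cyA : calabi_yau_2n A).
Variables (T : C) (tiltT : cluster_tilting A T).
Local Notation S := (susp A).
Local Notation L := (End_alg T).
Local Notation F := (homT T).
Implicit Types X Y Z : C.

Lemma homT_exact X Y Z (f : hom X Y) (g : hom Y Z) : exact_pair f g ->
  limg (homT_mor T f) = lker (homT_mor T g).
Proof.
move=> [gf ex]; apply/eqP; rewrite eqEsubv; apply/andP; split; apply/subvP => t.
  case/memv_imgP => t' _ ->; rewrite memv_ker !homT_morE compA gf.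
  by rewrite comp0m.
rewrite memv_ker homT_morE => /eqP /ex[w ->].
by rewrite -homT_morE memv_img ?memvf.
Qed.

(** In a presentation [T2 -> T1 -> X], Yoneda turns the composite with [h] into [u : T1 -> Z], which
    vanishes on [T2] and so descends to [X]. The descended map induces [h] because [C(T, S T0) = 0]
    lets every [T -> X] factor through [T1]. *)
Lemma homT_full X Z (h : 'Hom(F X, F Z)) :
  h \in homR (F X) (F Z) -> exists x, h = homT_mor T x.
Proof.
move=> hR; have [T2 [T1 [T0 [d [l [h0 [aT2 aT1 aT0 exd exl]]]]]]] :=
  tilting_presentation splitC tiltT X.
have [u uE] := homT_full_add aT1 (homR_comp hR (homT_mor_homR T l)).
have uE' t : u \oC t = h (l \oC t) by rewrite -homT_morE -uE comp_lfunE homT_morE.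
have [|v vE] := exact_pair_contra cyA exd (z := u).
  apply: (homT_mor_inj aT2) => t; rewrite -compA uE' compA exd.1 !comp0m.
  by rewrite linear0.
exists v; apply/lfunP => t; rewrite homT_morE.
have [w ->] := exl.2 _ t (hom_zero_tilting tiltT (add_closure_refl T) aT0 _).
by rewrite -uE' vE compA.
Qed.

Lemma homR_homT_ghost X Z :
  homR (F X) (F Z) = 0%VS <-> forall f : hom X Z, ghost T f.
Proof.
rewrite homR_eq0; split=> [z f t|z f].
  by rewrite -homT_morE (z _ (homT_mor_homR T f)) zero_lfunE.
by case/homT_full => x ->; apply/lfunP => t; rewrite homT_morE z zero_lfunE.
Qed.

Lemma homT_iso_reduced X Y : reduced T X -> reduced T Y ->
  mod_iso (F X) (F Y) -> iso_ob X Y.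
Proof.
move=> rX rY /mod_isoP[u [v [/homT_full[f ->] /homT_full[g ->] uK vK]]].
exists f; apply: (reduced_iso (T := T) (g := g)) => // t.
  by have := uK t; rewrite !homT_morE compA.
by have := vK t; rewrite !homT_morE compA.
Qed.

(** [F] turns an exact sequence with terms in add [T] into a projective resolution of [F Y], onto at
    the end because [C(T, Z) = 0]. The comparison is built from [Y] leftwards, one term per step. *)
Lemma comparison_exact_seq m X Y Z (c : seq_ m X Y) (h : hom Y Z)
    (R : nat -> rmod L) (d : forall i, 'Hom(R i.+1, R i)) :
  add_closure T X -> sall (add_closure T) c -> exact_seq c -> exact_last c h ->
  hom_zero T Z -> mod_iso (R 0) (F Y) -> limg (d 0) = fullv ->
  (forall i, (i < m)%N -> limg (d i.+1) = lker (d i)) ->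
  (forall i, (i <= m)%N -> [/\ projective (R i.+1), d i \in homR (R i.+1) (R i)
    & superfluous (lker (d i))]) ->
  comparison (homT_mor T (projT2 (shead c))) (d m).
Proof.
move=> aX aTc ex last z iso d0 exd dP.
elim: m X c aX aTc ex last exd dP => [|m IH] X c aX aTc ex last exd dP.
  have [prR dR sup] := dP 0%N isT.
  apply: comparison_base => //; first exact: mod_iso_sym.
  - exact: homT_dual_basis.
  - exact: projective_dual_basis.
  - exact: homT_mor_homR.
  - apply/eqP; rewrite eqEsubv subvf; apply/subvP => t _.
    have [w ->] := last.2 _ t (z _).
    by rewrite -homT_morE memv_img ?memvf.
case: c aTc ex last => Y1 [f c] [aY1 aTc] ex last.
have [prR dR sup] := dP m.+1 (leqnn _).
have [prR' dR' _] := dP m (leqW (leqnn _)).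
have comp : comparison (homT_mor T (projT2 (shead c))) (d m).
  apply: IH => // [j|i im|i im]; first by have [] := ex j.+1.
    exact/exd/leqW.
  exact/dP/leqW.
apply: (comparison_step comp) => //.
- exact: homT_dual_basis.
- exact: homT_dual_basis.
- exact: projective_dual_basis.
- exact: homT_mor_homR.
- exact: homT_mor_homR.
- by apply: homT_exact; have [] := ex 1%N.
- exact: exd.
Qed.

Lemma factor_through_connecting X T0 T1 (d0 : hom T0 T1) (c : seq_ n T1 X)
    (h : hom X (S T0)) (z : hom X (S T)) :
  add_closure T T0 -> add_closure T T1 -> sall (add_closure T) c ->
  exact_last (scons d0 c) h -> exists x : hom T0 T, z = aut_mor S x \oC h.
Proof.
move=> aT0 aT1 aTc last.
have [T' [l [aT' exl]]] := exact_last_pair (P := add_closure T) (m := n.+1)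
  (c := scons d0 c) aT0 (conj aT1 aTc) last.
have [|w ->] := exact_pair_contra cyA exl (z := z).
  exact: (hom_zero_tilting tiltT aT' (add_closure_refl T)).
by have [x ->] := aut_surj w; exists x.
Qed.

(* With T0 -> ... -> X -> S T0 the chosen angle, f : F T0 -> P_n the comparison map
   and phi the duality, u : T -> S X is sent to the functional y |-> phi u (S x h),
   where x : T0 -> T corresponds to y f. *)
Lemma tau_resolution X (R : nat -> rmod L) (d : forall i, 'Hom(R i.+1, R i)) :
  reduced T X -> mod_iso (R 0) (F X) -> limg (d 0) = fullv ->
  (forall i, (i < n.+1)%N -> limg (d i.+1) = lker (d i)) ->
  (forall i, (i <= n.+1)%N -> [/\ projective (R i.+1), d i \in homR (R i.+1) (R i)
    & superfluous (lker (d i))]) ->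
  exists j : 'Hom(F (S X), nu (R n.+2)),
    [/\ j \in homR (F (S X)) (nu (R n.+2)), lker j = 0%VS
      & limg j = lker (nu_mor (d n.+1))].
Proof.
move=> rX iso dS exd dP.
have [T0 [T1 [d0 [c [h [aT0 aT1 aTc ex [last exh]]]]]]] := tilting_angle splitC tiltT X.
have zT0 := hom_zero_tilting tiltT (add_closure_refl T) aT0.
have : comparison (homT_mor T d0) (d n.+1).
  exact: (comparison_exact_seq (c := scons d0 c) aT0 (conj aT1 aTc) ex last zT0
    iso dS exd dP).
have [_ dR _] := dP n.+1 (leqnn _).
move: (d n.+1) dR => {ex iso dS exd dP}; set Q := R n.+2; set Q' := R n.+1 => D DR.
case=> f g f' g' s b b' fR gR f'R g'R sR bR b'R fE gE gfs bfg fgb bfg' fgb'.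
have [phi [bij nat]] := cyA.
have [s0 s0E] := aT0.
pose x (y : subvs_of (homR Q (regmod L))) : hom T0 T :=
  \sum_(a <- s0) (vsval y (f a.2) : hom T T) \oC a.1.
have xE y t : x y \oC t = vsval y (f t).
  rewrite comp_suml -[t in RHS]comp1m -s0E comp_suml !linear_sum.
  apply: eq_bigr => a _; rewrite -!compA.
  have E := homR_act (a.2 : F T0) (a.1 \oC t : L) fR.
  have E' := homR_act (f a.2) (a.1 \oC t : L) (subvsP y).
  exact: (esym (etrans (congr1 (fun q => vsval y q) E) E')).
have xI (y : subvs_of (homR Q (regmod L))) (x' : hom T0 T) :
    (forall t : hom T T0, vsval y (f t) = x' \oC t) -> x y = x'.
  by move=> E; apply: (homT_mor_inj aT0) => t; rewrite xE.
have factor := factor_through_connecting (d0 := d0) _ aT0 aT1 aTc last.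
have dh0 : aut_mor S d0 \oC h = 0 := exh.1.
have [|B BE] := @linear_lfun k (subvs_of (homR Q (regmod L))) (hom X (S T))
    (fun y => aut_mor S (x y) \oC h).
  move=> a y y'; rewrite -compZl -compDl -autZ -autD; congr (aut_mor S _ \oC h).
  apply: xI => t; rewrite compDl compZl !xE.
  by rewrite dual_valP.
have [||j jR jE] := @exists_homR _ _ (F (S X)) (nu Q) (fun u => (phi T X u \o B)%VF).
- by move=> a u v; rewrite linearP comp_lfunDl -comp_lfunZl.
- move=> u a; apply/lfunP => y; rewrite nu_actE !comp_lfunE !BE.
  have := nat T T X X a (idm X) u (aut_mor S (x y) \oC h).
  rewrite aut_id comp1m compm1 => ->; rewrite compA -aut_comp.
  congr (phi T X u (aut_mor S _ \oC h)); apply/esym/xI => t.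
  by rewrite dual_actE -compA xE.
have gamma := homT_full_add aT0 (homR_comp gR fR); case: gamma => gam gamE.
have [sig sigE] := homT_full_add aT1 sR.
have gamE' t : gam \oC t = g (f t) by rewrite -homT_morE -gamE comp_lfunE.
(* What remains of [idm T0] after the round trip [g f] and the homotopy. As [d0 eps = 0], exactness
   at [S T0] gives [S eps = h w]. *)
pose eps := idm T0 - gam - sig \oC d0.
have deps : d0 \oC eps = 0.
  apply: (homT_mor_inj aT0) => t; rewrite comp0m -compA /eps !compBl comp1m gamE'.
  rewrite -addrA -opprD compBr.
  have := gfs t; rewrite sigE !homT_morE compA => ->.
  by rewrite subrr.
have [w epsE] : exists w, aut_mor S eps = h \oC w.
  by apply: exh.2; rewrite -aut_comp deps aut0.
(* [w h] is a ghost since it passes through [S T0]. As [S d0 h = 0], this will give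
   [S gam h = h (1 - w h)]: composed with [h], the defect of [g f] becomes an invertible
   endomorphism of [X]. *)
have [rho [rhw _]] : is_iso (idm X - w \oC h).
  by apply: rX => t; rewrite -compA (zT0 (h \oC t)) compm0.
have gamE2 : gam = idm T0 - eps - sig \oC d0.
  have <- : eps + (gam + sig \oC d0) = idm T0.
    by rewrite /eps addrC -(addrA (idm _)) -opprD addrC subrK.
  by rewrite [eps + _]addrC addrK addrK.
clearbody eps.
have gamh : aut_mor S gam \oC h = h \oC (idm X - w \oC h).
  rewrite gamE2 !autB aut_id !compBl comp1m aut_comp -compA dh0 compm0 subr0.
  by rewrite epsE compBr compm1 compA.
exists j; split=> //.
  (* Injectivity follows from surjectivity of [B]. Any [z] is [B y] for [y = x0 g], where
     [z rho = S x0 h]: the factor [rho] cancels [1 - w h]. *)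
  apply/eqP; rewrite -subv0; apply/subvP => u; rewrite memv_ker jE => /eqP ju.
  rewrite memv0; apply/eqP/(bij_inj (bij T X)); rewrite linear0.
  apply/lfunP => z; rewrite zero_lfunE.
  have [x0 x0E] := factor (z \oC rho).
  pose y := vsproj (homR Q (regmod L)) (homT_mor T x0 \o g)%VF.
  have yE q : vsval y q = x0 \oC g q.
    by rewrite vsprojK ?comp_lfunE ?homT_morE // (homR_comp (homT_mor_homR T x0) gR).
  have -> : z = B y.
    rewrite BE (xI y (x0 \oC gam)) => [|t]; last by rewrite yE -compA gamE'.
    by rewrite aut_comp -compA gamh compA -x0E -compA rhw compm1.
  by rewrite -comp_lfunE ju zero_lfunE.
apply/eqP; rewrite eqEsubv; apply/andP; split; apply/subvP => mu.
  case/memv_imgP => u _ ->; rewrite memv_ker jE; apply/eqP/lfunP => y.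
  rewrite nu_morE nu_mor_funE comp_lfunE BE.
  have [x1 x1E] := homT_full_add aT1 (homR_comp (subvsP y) f'R).
  rewrite (xI _ (x1 \oC d0)) => [|t].
    by rewrite aut_comp -compA dh0 compm0 linear0 zero_lfunE.
  by rewrite dual_morE // -fE -compA -homT_morE -x1E comp_lfunE homT_morE.
rewrite memv_ker => /eqP Dmu.
(* A functional killed by [nu D] vanishes on all [y' D]. Every [y] in the kernel of [B] has this
   form: exactness gives [x y = x1 d0], and then [y' = x1 g' b'] works because [b'] inverts [f' g'].
   Hence [mu] factors through [B], and the factor is dual to a map [T -> S X]. *)
have [|v vE] := @functional_factor k _ _ B mu.
  move=> y; rewrite BE => xyh.
  have [x2 x2E] := exact_pair_contra cyA exh xyh.
  have [x1 x1E] := aut_surj x2.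
  have {x1E} {}x2E : x y = x1 \oC d0 by apply: (@aut_inj k C S); rewrite aut_comp -x1E.
  pose y' := vsproj (homR Q' (regmod L)) (homT_mor T x1 \o g' \o b')%VF.
  have y'E q : vsval y' q = x1 \oC g' (b' q).
    rewrite vsprojK ?comp_lfunE ?homT_morE //.
    exact: (homR_comp (homR_comp (homT_mor_homR T x1) g'R) b'R).
  have -> : y = dual_mor D y'.
    apply: dual_ext => q; rewrite dual_morE // y'E -[in LHS](fgb q) -xE x2E -compA.
    congr (x1 \oC _); rewrite -[d0 \oC _]homT_morE -gE; congr (g' _).
    rewrite -[RHS]/(b' (D q)) -[in RHS](fgb q) -fE -gE bfg' //.
  by rewrite -nu_mor_funE -nu_morE Dmu zero_lfunE.
have [psi _ phiK] := bij T X.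
have -> : mu = j (psi v); last exact: memv_img (memvf _).
by apply/lfunP => y; rewrite jE comp_lfunE phiK vE.
Qed.

Lemma mod_iso_same_image (M N P : rmod L) (i : 'Hom(M, P)) (j : 'Hom(N, P)) :
  i \in homR M P -> j \in homR N P -> lker i = 0%VS -> lker j = 0%VS ->
  limg i = limg j -> mod_iso M N.
Proof.
move=> iR jR /eqP/lker0P iI /eqP/lker0P jI ij.
have jh m : j (j^-1%VF (i m)) = i m by rewrite limg_lfunVK // -ij memv_img ?memvf.
have ih m : i (i^-1%VF (j m)) = j m by rewrite limg_lfunVK // ij memv_img ?memvf.
have [||h hR hE] := @exists_homR _ _ M N (fun m => j^-1%VF (i m)).
- by move=> c x y; rewrite !linearP.
- by move=> m a; apply: jI; rewrite jh homR_act // homR_act // jh.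
exists h => //; exists (fun m => i^-1%VF (j m)) => m.
  by apply: iI; rewrite ih hE jh.
by apply: jI; rewrite hE jh ih.
Qed.

Lemma tau_homT X N : reduced T X -> mod_iso (F X) N -> is_tau n.+1 N (F (S X)).
Proof.
move=> rX iso; have [R [d [isoN dS exd dP]]] := minimal_resolution splitC N.
have [|||||j [jR j0 jK]] := @tau_resolution X R d => //.
  exact: mod_iso_trans (mod_iso_sym iso).
by exists R, d; split=> //; exists j.
Qed.

(** [tau_resolution] applies to every minimal resolution, hence to the one hidden in [is_tau]; two
    injections with the same image have isomorphic sources. *)
Lemma tau_homT_unique X N M : reduced T X -> mod_iso (F X) N -> is_tau n.+1 N M ->
  mod_iso (F (S X)) M.
Proof.
move=> rX iso [R [d [isoN [dS exd] dP [i [iR i0 iK]]]]].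
have [|||||j [jR j0 jK]] := @tau_resolution X R d => //.
  exact: mod_iso_trans (mod_iso_sym iso).
by apply: (mod_iso_same_image jR iR); rewrite ?iK.
Qed.

Lemma hom_tau_zero_ghost X Y M N : reduced T Y ->
  mod_iso (F X) M -> mod_iso (F Y) N ->
  hom_tau_zero n.+1 M N <-> forall f : hom X (S Y), ghost T f.
Proof.
move=> rY isoM isoN; rewrite -homR_homT_ghost; split=> [[Z tauZ z]|z].
  apply: homR_eq0_iso z; apply: mod_iso_sym => //.
  exact: tau_homT_unique isoN tauZ.
exists (F (S Y)); first exact: tau_homT.
exact: homR_eq0_iso isoM (mod_iso_refl _) z.
Qed.

End TauModule.

(** * The correspondence *)

Section Correspondence.
Variables (k : fieldType) (n : nat) (C : lincat k) (A : angulated n.+1 C).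
Hypotheses (splitC : split_idempotents C) (cyA : calabi_yau_2n A).
Variables (T : C) (tiltT : cluster_tilting A T).
Local Notation S := (susp A).
Local Notation L := (End_alg T).
Local Notation F := (homT T).
Local Notation D := (@ess_image k C T).
Implicit Types (X Y Z : C) (M N P Q : rmod L) (p q : (rmod L * rmod L)%type).

Lemma n_rigid_add X Y : add_closure X Y -> n_rigid A X -> n_rigid A Y.
Proof.
move=> aXY rX; apply: (hom_zero_addl aXY); apply: hom_zero_addr rX.
exact/aut_add_closure.
Qed.

Lemma n_rigid_osum X Y :
  n_rigid A (X \o+ Y) <-> [/\ n_rigid A X, n_rigid A Y & hom_zero X (S Y)].
Proof.
split=> [rXY|[rX rY XY]].
  have [/hom_zero_aut_osum[rX XY] /hom_zero_aut_osum[_ rY]] :=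
    (hom_zero_osuml _ _ _).1 rXY.
  by split.
apply/hom_zero_osuml; split; apply/hom_zero_aut_osum; split=> //.
exact: hom_zero_cy.
Qed.

Lemma mod_add_iso M M' N N' :
  mod_iso M M' -> mod_iso N N' -> mod_add M N -> mod_add M' N'.
Proof.
move=> isoM isoN [r [N1 iso]]; exists r, N1.
apply: mod_iso_trans (modpow_iso r isoM); apply: mod_iso_trans iso.
by apply: modsum_iso; [apply: mod_iso_sym|apply: mod_iso_refl].
Qed.

(** Fullness of [F] lifts a decomposition of the identity of [F Y]; the error is a ghost, and
    reducedness of [Y] corrects it by an invertible factor. *)
Lemma mod_add_reduced X Y M N : reduced T X -> reduced T Y ->
  mod_iso (F X) M -> mod_iso (F Y) N -> mod_add M N <-> add_closure X Y.
Proof.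
move=> rX rY isoM isoN; split=> [aMN|/(in_addP splitC)]; last first.
  by move/mod_add_homT; apply.
have := mod_add_iso (mod_iso_sym isoM) (mod_iso_sym isoN) aMN.
move=> /mod_add_factors[s [sR sE]].
have [s' s'E] : exists s' : seq (hom Y X * hom X Y), forall t : hom T Y,
    (\sum_(a <- s') a.2 \oC a.1) \oC t = \sum_(a <- s) a.2 (a.1 t).
  elim: s sR {sE} => [|a s IH] sR.
    by exists [::] => t; rewrite !big_nil comp0m.
  have [|s' s'E] := IH; first by move=> b bs; apply: sR; rewrite inE bs orbT.
  have [a1R a2R] := sR a (mem_head _ _).
  have [x xE] := homT_full splitC cyA tiltT a1R.
  have [y yE] := homT_full splitC cyA tiltT a2R.
  exists ((x, y) :: s') => t; rewrite !big_cons compDl s'E.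
  by rewrite xE yE !homT_morE compA.
have [|v [_ E]] := rY (idm Y - \sum_(a <- s') a.2 \oC a.1).
  by move=> t; rewrite compBl comp1m s'E -sE subrr.
exists [seq (a.1 \oC v, a.2) | a <- s'].
rewrite big_map -E subKr comp_suml; apply: eq_bigr => a _.
by rewrite compA.
Qed.

(** A relation rather than a function, as [X'] and [T'] are determined only up to isomorphism; each
    proof may use the decomposition at hand. [class_map] turns it into a function on classes. *)
Definition corresponds X p : Prop := exists X' T',
  [/\ reduced T X', add_closure T T', iso_ob (X' \o+ S T') X,
      mod_iso (F X') p.1 & mod_iso (F T') p.2].

Lemma hom_zero_T_ST T' : add_closure T T' -> hom_zero T (S T').
Proof. by move=> aT'; apply: (hom_zero_tilting tiltT (add_closure_refl T) aT'). Qed.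

Lemma corresponds_homT X p : corresponds X p -> mod_iso (F X) p.1.
Proof.
move=> [X' [T' [_ aT' iso isoM _]]]; apply: mod_iso_trans isoM.
apply: mod_iso_trans (homT_osum_zero _ (hom_zero_T_ST aT')).
exact/homT_iso/iso_ob_sym.
Qed.

Lemma exists_reduced N : D N -> exists2 X, reduced T X & mod_iso (F X) N.
Proof.
case=> Y iso; have [X [T' [rX aT' isoY]]] := reduced_decomposition splitC cyA tiltT Y.
exists X => //; apply: mod_iso_trans iso.
apply: mod_iso_trans (homT_iso T isoY).
exact/mod_iso_sym/homT_osum_zero/hom_zero_T_ST.
Qed.

Lemma corresponds_total X : exists p, corresponds X p.
Proof.
have [X' [T' [rX aT' iso]]] := reduced_decomposition splitC cyA tiltT X.
by exists (F X', F T'), X', T'; split=> //; apply: mod_iso_refl.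
Qed.

Lemma corresponds_surj p : is_pair D p -> exists X, corresponds X p.
Proof.
case=> /exists_reduced[X' rX isoM] /(projective_homT splitC)[T' aT' isoP].
by exists (X' \o+ S T'), X', T'; split=> //; apply: iso_ob_refl.
Qed.

Lemma corresponds_is_pair X p : corresponds X p -> is_pair D p.
Proof.
move=> [X' [T' [_ aT' _ isoM isoP]]]; split; first by exists X'.
move=> M N g h gR gS hR.
have [u [v [uR vR uK vK]]] := (mod_isoP _ _).1 isoP.
have prF := dual_basis_projective (homT_dual_basis aT').
have [h' h'R h'E] := prF M N g (h \o u)%VF gR gS (homR_comp hR uR).
exists (h' \o v)%VF; first exact: homR_comp.
by apply/lfunP => x; rewrite comp_lfunA h'E !comp_lfunE vK.
Qed.

Lemma corresponds_iso X Y p q :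
  corresponds X p -> corresponds Y q -> iso_ob X Y <-> pair_iso p q.
Proof.
move=> [X' [T' [rX aT' isoX isoM isoP]]] [Y' [T'' [rY aT'' isoY isoN isoQ]]].
have [zT' zT''] := (hom_zero_T_ST aT', hom_zero_T_ST aT'').
split=> [iso|[isoMN isoPQ]].
  have := iso_ob_trans isoX (iso_ob_trans iso (iso_ob_sym isoY)).
  case/(osum_cancel rX rY zT' zT'') => isoX' /aut_iso isoT'; split.
    apply: mod_iso_trans isoN; apply: mod_iso_trans (homT_iso T isoX').
    exact: mod_iso_sym.
  apply: mod_iso_trans isoQ; apply: mod_iso_trans (homT_iso T isoT').
  exact: mod_iso_sym.
apply: iso_ob_trans isoY; apply: iso_ob_trans (iso_ob_sym isoX) _.
have isoF := homT_iso_reduced splitC cyA tiltT.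
apply: iso_ob_osum; last apply/aut_iso; apply: isoF => //.
- exact: mod_iso_trans isoM (mod_iso_trans isoMN (mod_iso_sym isoN)).
- exact: reduced_add.
- exact: reduced_add.
- exact: mod_iso_trans isoP (mod_iso_trans isoPQ (mod_iso_sym isoQ)).
Qed.

Lemma corresponds_pair_iso X p q : corresponds X p -> pair_iso p q -> corresponds X q.
Proof.
move=> [X' [T' [rX aT' isoX isoM isoP]]] [isoMN isoPQ]; exists X', T'.
by split=> //; [apply: mod_iso_trans isoMN|apply: mod_iso_trans isoPQ].
Qed.

Lemma add_closure_isol X X' Y : iso_ob X X' -> add_closure X Y <-> add_closure X' Y.
Proof.
move=> iso; split; apply: add_closure_trans; apply: add_closure_iso => //.
exact: iso_ob_sym.
Qed.

(** The first of four lemmas that translate membership in add [X] and vanishing of [C(X, S -)] for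
    the two kinds of summands: suspensions of objects of add [T], and reduced objects. *)
Lemma add_closure_suspension X p T' Q : corresponds X p ->
  add_closure T T' -> mod_iso (F T') Q -> add_closure X (S T') <-> mod_add p.2 Q.
Proof.
move=> [X' [T'' [rX aT'' isoX isoM isoP]]] aT' isoQ.
rewrite (mod_add_reduced (reduced_add aT'') (reduced_add aT') isoP isoQ).
rewrite -(aut_add_closure S T'' T'); split=> aX.
  apply: (add_closure_ghost rX (hom_zero_T_ST aT')).
  exact/(add_closure_isol _ isoX).
apply/(add_closure_isol _ isoX); apply: add_closure_trans aX.
exact: add_closure_inr.
Qed.

(** By duality [C(X, S (S T'))] vanishes together with [C(S T', S X)], that is, with [C(T', X)],
    which Yoneda identifies with a Hom-space of modules. *)
Lemma hom_zero_suspension X p T' Q : corresponds X p ->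
  add_closure T T' -> mod_iso (F T') Q ->
  hom_zero X (S (S T')) <-> homR Q p.1 = 0%VS.
Proof.
move=> /corresponds_homT isoM aT' isoQ.
have -> : hom_zero X (S (S T')) <-> hom_zero T' X.
  by rewrite -(aut_hom_zero S T' X); split; apply: hom_zero_cy.
rewrite -(homR_homT_zero _ aT'); split; first exact: homR_eq0_iso.
by apply: homR_eq0_iso; apply: mod_iso_sym.
Qed.

Lemma add_closure_corresponds X p Y N : corresponds X p ->
  reduced T Y -> mod_iso (F Y) N -> add_closure X Y <-> mod_add p.1 N.
Proof.
move=> [X' [T' [rX aT' isoX isoM isoP]]] rY isoN.
rewrite (mod_add_reduced rX rY isoM isoN); split=> aX.
  apply: (add_closure_reduced rY (hom_zero_T_ST aT')).
  exact/(add_closure_isol _ isoX).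
apply/(add_closure_isol _ isoX); apply: add_closure_trans aX.
exact: add_closure_inl.
Qed.

Lemma hom_zero_corresponds X p Y N : corresponds X p ->
  reduced T Y -> mod_iso (F Y) N -> hom_zero X (S Y) <->
  [/\ hom_tau_zero n.+1 p.1 N, hom_tau_zero n.+1 N p.1 & homR p.2 N = 0%VS].
Proof.
move=> [X' [T' [rX aT' isoX isoM isoP]]] rY isoN.
rewrite -(hom_zero_isol _ isoX) hom_zero_osuml aut_hom_zero.
rewrite (hom_zero_ghosts splitC cyA tiltT X' Y) -(homR_homT_zero _ aT').
rewrite -(hom_tau_zero_ghost splitC cyA tiltT rY isoM isoN).
rewrite -(hom_tau_zero_ghost splitC cyA tiltT rX isoN isoM).
split=> [[[? ?] z]|[? ? z]]; split=> //; first exact: homR_eq0_iso z.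
by apply: homR_eq0_iso z; apply: mod_iso_sym.
Qed.

Lemma n_rigid_corresponds X p : corresponds X p ->
  n_rigid A X <-> tau_rigid_pair D n.+1 p.
Proof.
move=> cX; have [X' [T' [rX aT' isoX isoM isoP]]] := cX.
rewrite /n_rigid.
have /hom_zero_isor <- : iso_ob (S (X' \o+ S T')) (S X) by apply/aut_iso.
rewrite hom_zero_aut_osum (hom_zero_corresponds cX rX isoM).
rewrite (hom_zero_suspension cX aT' isoP).
split=> [[[? _ ?] _]|[_ ? ?]]; split=> //; exact: corresponds_is_pair cX.
Qed.

(** Rigidity depends only on the additive closure. [X (+) Y] has the same one as [W], whose
    decomposition visibly corresponds to the enlarged pair. *)
Lemma n_rigid_osum_reduced X p Y N : corresponds X p -> reduced T Y ->
  mod_iso (F Y) N -> n_rigid A (X \o+ Y) <-> tau_rigid_pair D n.+1 (modsum p.1 N, p.2).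
Proof.
move=> [X' [T' [rX aT' isoX isoM isoP]]] rY isoN.
set W := (X' \o+ Y) \o+ S T'.
have cW : corresponds W (modsum p.1 N, p.2).
  exists (X' \o+ Y), T'; split=> //; first exact: reduced_osum.
    exact: iso_ob_refl.
  exact: mod_iso_trans (homT_osum _ _ _) (modsum_iso isoM isoN).
have aWX' : add_closure W X'.
  exact: add_closure_trans (add_closure_inl _ _) (add_closure_inl _ _).
have aWY : add_closure W Y.
  exact: add_closure_trans (add_closure_inl _ _) (add_closure_inr _ _).
rewrite -(n_rigid_corresponds cW); split; apply: n_rigid_add.
  have aX := add_closure_iso (iso_ob_sym isoX).
  have aXX' := add_closure_trans aX (add_closure_inl _ _).
  have aXT' := add_closure_trans aX (add_closure_inr _ _).
  apply: add_closure_osum; last exact: add_closure_trans (add_closure_inl _ _) aXT'.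
  apply: add_closure_osum (add_closure_inr _ _).
  exact: add_closure_trans (add_closure_inl _ _) aXX'.
apply: add_closure_osum => //; apply: add_closure_trans (add_closure_iso isoX).
by apply: add_closure_osum => //; apply: add_closure_inr.
Qed.

Lemma add_closure_decomposition X Y T' Z : iso_ob (Y \o+ S T') Z ->
  add_closure X Z <-> add_closure X Y /\ add_closure X (S T').
Proof.
move=> /[dup] /add_closure_iso aZ /iso_ob_sym/add_closure_iso aZ'; split=> [a|[a a']].
  by split; apply: add_closure_trans a (add_closure_trans aZ' _);
    [apply: add_closure_inl|apply: add_closure_inr].
exact: add_closure_trans (add_closure_osum a a') aZ.
Qed.

Lemma maximal_n_rigid_corresponds X p : corresponds X p ->
  maximal_n_rigid A X <-> support_tau_tilting_pair D n.+1 p.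
Proof.
move=> cX; rewrite /maximal_n_rigid (n_rigid_corresponds cX); split=> -[rp].
  have rX := (n_rigid_corresponds cX).2 rp.
  move=> maxX; split=> // [N DN|Q prQ].
    have [Y rY isoN] := exists_reduced DN.
    move=> /(n_rigid_osum_reduced cX rY isoN)/maxX/(in_addP splitC).
    by move/(add_closure_corresponds cX rY isoN).
  have [T' aT' isoQ] := projective_homT splitC prQ.
  rewrite -(add_closure_suspension cX aT' isoQ) -(hom_zero_suspension cX aT' isoQ).
  (* [S T'] is itself rigid, so adding it to the rigid object [X] only tests [C(X, S (S T'))]. *)
  rewrite -(in_addP splitC) maxX n_rigid_osum; split=> [[]//|z]; split=> //.
  by apply/aut_hom_zero/(hom_zero_tilting tiltT).
move=> maxM maxP; split=> // Z; rewrite (in_addP splitC).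
have rX := (n_rigid_corresponds cX).2 rp.
split=> [aZ|rXZ].
  by apply: n_rigid_add rX; apply: add_closure_osum aZ; apply: add_closure_refl.
have [Y [T' [rY aT' isoZ]]] := reduced_decomposition splitC cyA tiltT Z.
have aZ := add_closure_iso (iso_ob_sym isoZ).
apply/(add_closure_decomposition _ isoZ); split.
  apply/(add_closure_corresponds cX rY (mod_iso_refl _)); apply: maxM.
    by exists Y; apply: mod_iso_refl.
  apply/(n_rigid_osum_reduced cX rY (mod_iso_refl _)).
  apply: n_rigid_add rXZ; apply: add_closure_osum; first exact: add_closure_inl.
  apply: add_closure_trans (add_closure_inr _ _) (add_closure_trans aZ _).
  exact: add_closure_inl.
apply/(add_closure_suspension cX aT' (mod_iso_refl _)).
apply/maxP; first exact/dual_basis_projective/homT_dual_basis.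
apply/(hom_zero_suspension cX aT' (mod_iso_refl _)).
have [_ _ XZ] := (n_rigid_osum _ _).1 rXZ.
apply: hom_zero_addr XZ; apply/aut_add_closure.
by apply: add_closure_trans aZ _; apply: add_closure_inr.
Qed.

Lemma self_perpendicular_corresponds X p : corresponds X p ->
  n_self_perpendicular A X <-> maximal_tau_rigid_pair D n.+1 p.
Proof.
move=> cX.
(* By duality the two halves of self-perpendicularity are equivalent. *)
have -> : n_self_perpendicular A X <-> forall Z, add_closure X Z <-> hom_zero X (S Z).
  split=> [[perp _] Z|perp]; first by rewrite -(in_addP splitC).
  by split=> Z; rewrite (in_addP splitC) perp //; split; apply: hom_zero_cy.
split=> [perp|[_ maxM maxP] Z].
  split=> [|N /exists_reduced[Y rY isoN]|Q /(projective_homT splitC)[T' aT' isoQ]].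
  - exact: corresponds_is_pair cX.
  - rewrite -(add_closure_corresponds cX rY isoN) perp.
    by rewrite (hom_zero_corresponds cX rY isoN).
  - rewrite -(add_closure_suspension cX aT' isoQ) perp.
    by rewrite (hom_zero_suspension cX aT' isoQ).
have [Y [T' [rY aT' isoZ]]] := reduced_decomposition splitC cyA tiltT Z.
rewrite (add_closure_decomposition _ isoZ).
have /hom_zero_isor <- : iso_ob (S (Y \o+ S T')) (S Z) by apply/aut_iso.
rewrite hom_zero_aut_osum (hom_zero_corresponds cX rY (mod_iso_refl _)).
rewrite (hom_zero_suspension cX aT' (mod_iso_refl _)).
rewrite (add_closure_corresponds cX rY (mod_iso_refl _)).
rewrite (add_closure_suspension cX aT' (mod_iso_refl _)).
rewrite maxM ?maxP //; last by exists Y; apply: mod_iso_refl.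
exact/dual_basis_projective/homT_dual_basis.
Qed.

Definition class_map (c : C -> Prop) : (rmod L * rmod L) -> Prop :=
  fun p => exists2 X, c X & corresponds X p.

Lemma class_mapE X p : corresponds X p -> class_map (@iso_ob k C X) = @pair_iso k L p.
Proof.
move=> cX; apply: functional_extensionality => q; apply: propositional_extensionality.
split=> [[Y iso cY]|iso]; first exact/(corresponds_iso cX cY).
by exists X; [apply: iso_ob_refl|apply: corresponds_pair_iso cX iso].
Qed.

(** Stated for arbitrary matching predicates, so that one and the same map yields all three
    bijections. *)
Lemma class_map_bij (P : C -> Prop) (Q : (rmod L * rmod L) -> Prop) :
  (forall X p, corresponds X p -> P X <-> Q p) -> (forall p, Q p -> is_pair D p) ->
  bij_between (iso_classes (@iso_ob k C) P) (iso_classes (@pair_iso k L) Q) class_map.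
Proof.
move=> PQ Qpair; split=> [c [X PX ->]|c c' [X PX ->] [Y PY ->]|c [p Qp ->]].
- have [p cX] := corresponds_total X; exists p; first exact/(PQ X).
  exact: class_mapE.
- have [p cX] := corresponds_total X; have [q cY] := corresponds_total Y.
  rewrite (class_mapE cX) (class_mapE cY) => E.
  have : pair_iso p q by rewrite E; split; apply: mod_iso_refl.
  move/(corresponds_iso cX cY) => iso.
  apply: functional_extensionality => Z; apply: propositional_extensionality.
  by split; apply: iso_ob_trans => //; apply: iso_ob_sym.
- have [X cX] := corresponds_surj (Qpair p Qp).
  exists (@iso_ob k C X); last exact: class_mapE.
  by exists X => //; apply/(PQ X p).
Qed.

End Correspondence.

Theorem corollary1p6 (n : nat) (hn : (1 <= n)%N) (k : fieldType)
    (C : lincat k) (A : angulated n C)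
    (hidem : split_idempotents C) (hCY : calabi_yau_2n A)
    (T : C) (hT : cluster_tilting A T) :
  let D := @ess_image k C T in
  exists f : (C -> Prop) -> (rmod (End_alg T) * rmod (End_alg T) -> Prop),
    [/\ bij_between
          (iso_classes (@iso_ob k C) (n_rigid A))
          (iso_classes (@pair_iso k (End_alg T)) (tau_rigid_pair D n)) f,
        bij_between
          (iso_classes (@iso_ob k C) (maximal_n_rigid A))
          (iso_classes (@pair_iso k (End_alg T)) (support_tau_tilting_pair D n)) f
      & bij_between
          (iso_classes (@iso_ob k C) (n_self_perpendicular A))
          (iso_classes (@pair_iso k (End_alg T)) (maximal_tau_rigid_pair D n)) f].
Proof.
case: n hn A hCY hT => // n _ A hCY hT D; exists (@class_map k n C A T).
split; apply: class_map_bij => //.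
- by move=> X p; apply: n_rigid_corresponds.
- by move=> p [].
- by move=> X p; apply: maximal_n_rigid_corresponds.
- by move=> p [[]].
- by move=> X p; apply: self_perpendicular_corresponds.
- by move=> p [].
Qed.
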